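(* Let $p\in\mathbb N$ and let $c_1,\dots,c_p\in\mathbb R$ be pairwise distinct. Let $\vec n=(n_1,\dots,n_p)\in\mathbb N_0^p$ and $i\in\{1,\dots,p\}$ with $n_i\ge1$. Then the multiple Hermite polynomial of type I, $H^{(i)}_{\vec n}(x;c_1,\dots,c_p)$ (defined by the orthogonality conditions in the context), is $$H^{(i)}_{\vec n}(x;c_1,\dots,c_p)=\frac{(-1)^{n_i-1}}{\sqrt\pi\,(n_i-1)!}\,\frac{2^{|\vec n|-1}\exp\left(-\frac{c_i^2}{4}\right)}{\prod_{q=1,q\ne i}^p(c_i-c_q)^{n_q}}\sum_{l_1=0}^{n_i-1}\cdots\sum_{l_p=0}^{n_i-1-l_1-\cdots-l_{p-1}}\frac{(-n_i+1)_{l_1+\cdots+l_p}}{l_i!}\prod_{q=1,q\ne i}^p\frac{(n_q)_{l_q}}{l_q!\,(c_q-c_i)^{l_q}}\,H_{n_i-1-l_1-\cdots-l_p}\left(\frac{c_i}{2}\right)x^{l_i},$$ where $H_n$ are the monic Hermite polynomials given in the context. Moreover, it is obtained from the type I Jacobi--Piñeiro polynomials $P^{(i)}_{\vec n}$ given in the context through the limit $$H^{(i)}_{\vec n}(x;c_1,\dots,c_p)=\lim_{\beta\to\infty}\frac{1}{\left(2\sqrt\beta\right)^{|\vec n|}2^{2\beta+c_i\sqrt\beta}}\,P^{(i)}_{\vec n}\left(\frac{x+\sqrt\beta}{2\sqrt\beta};\,\beta+c_1\sqrt\beta,\dots,\beta+c_p\sqrt\beta,\,\beta\right),$$ and from the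 type I multiple Laguerre polynomials of the first kind $L^{(i)}_{\vec n}$ given in the context through the limit $$H^{(i)}_{\vec n}(x;c_1,\dots,c_p)=\lim_{\beta\to\infty}\left(\sqrt{2\beta}\right)^{|\vec n|}\beta^{\,\beta+c_i\sqrt{\beta/2}}\,e^{-\beta}\,L^{(i)}_{\vec n}\left(\sqrt{2\beta}\,x+\beta;\,\beta+c_1\sqrt{\tfrac\beta2},\dots,\beta+c_p\sqrt{\tfrac\beta2}\right).$$
   Context: $\mathbb N_0=\{0,1,2,\dots\}$; $|\vec n|=n_1+\cdots+n_p$; $(x)_0=1$, $(x)_n=x(x+1)\cdots(x+n-1)$. The multiple Hermite polynomials of type I, for $|\vec n|\ge1$, are the unique polynomials $H^{(1)}_{\vec n},\dots,H^{(p)}_{\vec n}$ with $\deg H^{(i)}_{\vec n}\le n_i-1$ ($H^{(i)}_{\vec n}=0$ if $n_i=0$) satisfying $$\sum_{i=1}^p\int_{-\infty}^{\infty}x^jH^{(i)}_{\vec n}(x)\,e^{-x^2+c_ix}\,dx=\begin{cases}0,&j=0,\dots,|\vec n|-2,\\1,&j=|\vec n|-1.\end{cases}$$ Monic Hermite polynomials: $H_n(x)=\sum_{k=0}^{\lfloor n/2\rfloor}(-1)^k\frac{(-n)_{2k}}{k!}\frac{x^{n-2k}}{2^{2k}}$, $n\in\mathbb N_0$. Type I Jacobi--Piñeiro polynomials ($n_i\ge1$): $$P^{(i)}_{\vec n}(x;\alpha_1,\dots,\alpha_p,\beta)=(-1)^{|\vec n|-1}\frac{\prod_{q=1}^p(\alpha_q+\beta+|\vec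 n|)_{n_q}}{(n_i-1)!\prod_{q\ne i}(\alpha_q-\alpha_i)_{n_q}}\,\frac{\Gamma(\alpha_i+\beta+|\vec n|)}{\Gamma(\beta+|\vec n|)\Gamma(\alpha_i+1)}\sum_{l=0}^{n_i-1}\frac{(-n_i+1)_l(\alpha_i+\beta+|\vec n|)_l}{l!\,(\alpha_i+1)_l}\prod_{q\ne i}\frac{(\alpha_i-\alpha_q-n_q+1)_l}{(\alpha_i-\alpha_q+1)_l}\,x^l .$$ Type I multiple Laguerre polynomials of the first kind ($n_i\ge1$): $$L^{(i)}_{\vec n}(x;\alpha_1,\dots,\alpha_p)=\frac{(-1)^{|\vec n|-1}}{(n_i-1)!\,\Gamma(\alpha_i+1)\prod_{q\ne i}(\alpha_q-\alpha_i)_{n_q}}\sum_{l=0}^{n_i-1}\frac{(-n_i+1)_l}{l!\,(\alpha_i+1)_l}\prod_{q\ne i}\frac{(\alpha_i-\alpha_q-n_q+1)_l}{(\alpha_i-\alpha_q+1)_l}\,x^l .$$ Both are well defined for the parameters in the limits as soon as $\beta$ is large enough. *)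

(* Defs.v *)
From HB Require Import structures.
From mathcomp Require Import all_boot all_order all_algebra.
From mathcomp Require Import all_classical all_reals all_analysis.

Set Implicit Arguments.
Unset Strict Implicit.
Unset Printing Implicit Defensive.
Import Order.TTheory GRing.Theory Num.Theory.
Import numFieldNormedType.Exports.
Local Open Scope classical_set_scope.
Local Open Scope ring_scope.

Definition pochhammer (R : realType) (x : R) (n : nat) : R :=
  \prod_(k < n) (x + k%:R).

(* Euler's integral, continued to x <= 0 by
   Gamma(x) = Gamma(x + m) / (x (x + 1) ... (x + m - 1));
   m is the least natural number with x + m > 0, in particular m = 0 if x > 0.
   The value at the poles is 0. *)
Definition Gamma (R : realType) (x : R) : R :=
  let m := Num.truncn (1 - x) in
  (\int[lebesgue_measure]_(t in `]0, +oo[) (t `^ (x + m%:R - 1) * expR (- t)))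
    / pochhammer x m.

Definition vsize (p : nat) (n : 'I_p -> nat) : nat := (\sum_(i < p) n i)%N.

Definition hermite (R : realType) (n : nat) : {poly R} :=
  \sum_(k < n./2.+1)
    ((-1) ^+ k * pochhammer (- n%:R) k.*2 / k`!%:R / 2 ^+ k.*2)
      *: 'X^(n - k.*2).

(* size P <= m means deg P <= m - 1, and P = 0 if m = 0. *)
Definition is_multiple_hermiteI (R : realType) (p : nat)
    (n : 'I_p -> nat) (c : 'I_p -> R) (H : {ffun 'I_p -> {poly R}}) : Prop :=
  (forall i, (size (H i) <= n i)%N) /\
  (forall j : nat, (j < vsize n)%N ->
     \sum_(i < p) \int[lebesgue_measure]_(x in [set: R])
        (x ^+ j * (H i).[x] * expR (- x ^+ 2 + c i * x))
     = if j == (vsize n).-1 then 1 else 0).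

(* Definite description: if the conditions had no solution, or several, the
   value would be the zero family. *)
Definition multiple_hermiteI (R : realType) (p : nat)
    (n : 'I_p -> nat) (c : 'I_p -> R) : {ffun 'I_p -> {poly R}} :=
  xget [ffun=> 0] [set H | is_multiple_hermiteI n c H /\
    forall H', is_multiple_hermiteI n c H' -> H' = H].

Definition jacobi_pineiroI (R : realType) (p : nat)
    (n : 'I_p -> nat) (alpha : 'I_p -> R) (beta : R) (i : 'I_p) : {poly R} :=
  let N := vsize n in
  ((-1) ^+ N.-1
   * ((\prod_(q < p) pochhammer (alpha q + beta + N%:R) (n q))
      / ((n i).-1`!%:R
         * \prod_(q < p | q != i) pochhammer (alpha q - alpha i) (n q)))
   * (Gamma (alpha i + beta + N%:R)
      / (Gamma (beta + N%:R) * Gamma (alpha i + 1))))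
  *: \sum_(l < n i)
       (pochhammer (- (n i)%:R + 1) l * pochhammer (alpha i + beta + N%:R) l
        / (l`!%:R * pochhammer (alpha i + 1) l)
        * \prod_(q < p | q != i)
            (pochhammer (alpha i - alpha q - (n q)%:R + 1) l
             / pochhammer (alpha i - alpha q + 1) l))
       *: 'X^l.

Definition multiple_laguerreI (R : realType) (p : nat)
    (n : 'I_p -> nat) (alpha : 'I_p -> R) (i : 'I_p) : {poly R} :=
  ((-1) ^+ (vsize n).-1
   / ((n i).-1`!%:R * Gamma (alpha i + 1)
      * \prod_(q < p | q != i) pochhammer (alpha q - alpha i) (n q)))
  *: \sum_(l < n i)
       (pochhammer (- (n i)%:R + 1) l
        / (l`!%:R * pochhammer (alpha i + 1) l)
        * \prod_(q < p | q != i)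
            (pochhammer (alpha i - alpha q - (n q)%:R + 1) l
             / pochhammer (alpha i - alpha q + 1) l))
       *: 'X^l.

(* Main.v *)
Require Import Defs.
From HB Require Import structures.
From mathcomp Require Import all_boot all_order all_algebra.
From mathcomp Require Import all_classical all_reals all_analysis.
From mathcomp Require Import ring lra.
From mathcomp Require Import measurable_realfun.

Set Implicit Arguments.
Unset Strict Implicit.
Unset Printing Implicit Defensive.
Import Order.TTheory GRing.Theory Num.Theory.
Import numFieldNormedType.Exports.
Local Open Scope classical_set_scope.
Local Open Scope ring_scope.

(**
  The orthogonality conditions are solved by residues. With g(t) =
  exp(- t ^ 2 / 4), consider, up to a constant factor,
    Q(x) = sum_i Res_(t = c_i) g(t) exp(- x ^ 2 + t x) / prod_q (t - c_q) ^ n_q.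
  The residue at c_i is exp(- x ^ 2 + c_i x) times a polynomial in x of degree
  at most n_i - 1. Since the integral of x ^ j exp(- x ^ 2 + t x) is
  sqrt(pi) (d / dt) ^ j exp(t ^ 2 / 4) = sqrt(pi) h_j(t) exp(t ^ 2 / 4) with a
  polynomial h_j of degree j and leading coefficient 2 ^- j (weight_moment), the
  j-th moment of Q is a sum of residues of h_j(t) / prod_q (t - c_q) ^ n_q. By
  the residue theorem (residue_sumE, proved by cancelling factors t - c_q) it
  vanishes for j < N - 1, where N = |n|, and equals sqrt(pi) 2 ^- (N - 1) for j = N - 1.
  The solution is unique because a difference D of two solutions is orthogonal
  to all polynomials of degree less than N in a pairing that detects the leading
  coefficients of D (pairing_inj). Expanding exp(t x), the Hermite generating
  function g(c_i + s) / g(c_i) and the powers (c_i - c_q + s) ^- n_q at s = 0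
  gives the explicit formula (local_residue_sumE).

  For the limits, put m = n_i - 1. Since (-m)_l / l! = (-1) ^ l binom(m, l), the
  sums that define the Jacobi-Pineiro and Laguerre polynomials are m-th
  differences in l of a product of three kinds of factors. With a step 1 / s,
  where s is sqrt(beta) or sqrt(beta / 2), each factor is a discretization of one
  of the functions in the residue at c_i: the powers of the argument yield
  exp(x t) (taylor_cvg_exp), the ratios with alpha_i - alpha_q yield
  (1 + t / (c_i - c_q)) ^- n_q (taylor_cvg_binom), and the ratio left over yields
  exp(- c_i t / 2 - t ^ 2 / 4) (taylor_cvg_hermite). The last two follow from
  first-order recurrences in l, by which the k-th differences satisfy two- and
  three-term recurrences in k (fdiff_recurrence). Products of factors become
  products of Taylor series (taylor_cvgM), so s ^ m times the m-th difference
  converges to m! times the m-th Taylor coefficient, which is the residue up to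
  a constant factor (cvg_hypergeometric_sum).

  The prefactors are controlled by Stirling's formula, obtained by Laplace's
  method (Gamma_asymp) and then expanded around beta, where the quadratic term
  of the logarithm produces exp(- c_i ^ 2 / 4) (cvg_Gamma_shift,
  cvg_beta_ratio).
*)

(** * Power series modulo a power of the variable *)

Definition eqmodX (R : nzRingType) (M : nat) (p q : {poly R}) :=
  forall k, (k < M)%N -> p`_k = q`_k.

Definition series_poly (R : nzRingType) (M : nat) (a : nat -> R) : {poly R} :=
  \poly_(k < M) a k.

Section EqmodX.
Variable R : comNzRingType.
Implicit Types (p q : {poly R}) (M : nat) (a : nat -> R).

Lemma coef_series_poly M a k : (k < M)%N -> (series_poly M a)`_k = a k.
Proof. by move=> kM; rewrite coef_poly kM. Qed.

Lemma eqmodX_sym M p q : eqmodX M p q -> eqmodX M q p.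
Proof. by move=> pq k kM; rewrite pq. Qed.

Lemma eqmodX_trans M p q r : eqmodX M p q -> eqmodX M q r -> eqmodX M p r.
Proof. by move=> pq qr k kM; rewrite pq // qr. Qed.

Lemma eqmodX_add M p p' q q' :
  eqmodX M p p' -> eqmodX M q q' -> eqmodX M (p + q) (p' + q').
Proof. by move=> pp qq k kM; rewrite !coefD pp // qq. Qed.

Lemma eqmodX_mul M p p' q q' :
  eqmodX M p p' -> eqmodX M q q' -> eqmodX M (p * q) (p' * q').
Proof.
move=> pp qq k kM; rewrite !coefM; apply: eq_bigr => -[j /= jk] _.
rewrite pp ?qq //; first exact: leq_ltn_trans (leq_subr _ _) kM.
by rewrite ltnS in jk; exact: leq_ltn_trans jk kM.
Qed.

Lemma eqmodX_mull M p q q' : eqmodX M q q' -> eqmodX M (p * q) (p * q').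
Proof. exact: eqmodX_mul. Qed.

Lemma eqmodX_mulr M p p' q : eqmodX M p p' -> eqmodX M (p * q) (p' * q).
Proof. by move=> pp; exact: eqmodX_mul. Qed.

Lemma eqmodX_prod (I : Type) (r : seq I) (P : pred I) M (F G : I -> {poly R}) :
  (forall i, P i -> eqmodX M (F i) (G i)) ->
  eqmodX M (\prod_(i <- r | P i) F i) (\prod_(i <- r | P i) G i).
Proof.
by move=> FG; elim/big_rec2: _ => // i y x /FG; exact: eqmodX_mul.
Qed.

Lemma eqmodX_series M M' a : (M <= M')%N ->
  eqmodX M (series_poly M a) (series_poly M' a).
Proof.
move=> MM k kM; rewrite !coef_series_poly //; exact: leq_trans kM MM.
Qed.

Lemma eqmodX_deriv M p q : eqmodX M.+1 p q -> eqmodX M p^`() q^`().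
Proof. by move=> pq k kM; rewrite !coef_deriv pq. Qed.

(** Turns a coefficient of a product of series into a multiple sum of the kind
    that occurs in the explicit formula. *)
Lemma coef_prod_series (I : finType) M (a : I -> nat -> R) p m :
  ((\prod_i series_poly M (a i)) * p)`_m =
  \sum_(l : {ffun I -> 'I_M} | (\sum_i l i <= m)%N)
     (\prod_i a i (l i)) * p`_(m - \sum_i l i).
Proof.
under eq_bigr => i _ do rewrite /series_poly poly_def.
rewrite bigA_distr_bigA /= mulr_suml coef_sum [RHS]big_mkcond /=.
apply: eq_bigr => l _.
have -> : \prod_(i in I) (a i (l i) *: 'X^(l i)) =
    (\prod_i a i (l i)) *: 'X^(\sum_i l i) :> {poly R}.
  rewrite scaler_prod; congr (_ *: _).
  by elim/big_rec2: _ => [|i y x _ ->]; rewrite ?expr0 // exprD.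
by rewrite -scalerAl coefZ coefXnM; case: ltnP => //= _; rewrite mulr0.
Qed.

End EqmodX.

(** * Partial fractions at the nodes *)

Section Pochhammer.
Variable R : realType.
Implicit Types (x : R) (n : nat).

Lemma pochhammer0 x : pochhammer x 0 = 1.
Proof. by rewrite /pochhammer big_ord0. Qed.

Lemma pochhammerS x n : pochhammer x n.+1 = pochhammer x n * (x + n%:R).
Proof. by rewrite /pochhammer big_ord_recr. Qed.

Lemma pochhammerSl x n : pochhammer x n.+1 = x * pochhammer (x + 1) n.
Proof.
rewrite /pochhammer big_ord_recl /= addr0; congr (_ * _).
by apply: eq_bigr => k _; rewrite /bump /= -addrA add1n -natr1 [1 + _]addrC.
Qed.

Lemma factS_neq0 n : n`!%:R != 0 :> R.
Proof. by rewrite pnatr_eq0 -lt0n fact_gt0. Qed.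

Lemma pochhammer_oppn n k : (k <= n)%N ->
  pochhammer (- n%:R : R) k = (-1) ^+ k * n`!%:R / (n - k)`!%:R.
Proof.
elim: k => [|k IH] kn; first by rewrite pochhammer0 subn0 mul1r divff ?factS_neq0.
rewrite pochhammerS IH; last exact: ltnW.
have -> : (n - k = (n - k.+1).+1)%N by rewrite subnS prednK // subn_gt0.
have -> : n%:R = (n - k.+1)%:R + k.+1%:R :> R by rewrite -natrD subnK.
rewrite factS natrM exprS.
have h1 := factS_neq0 (n - k.+1).
have h2 : (n - k.+1).+1%:R != 0 :> R by rewrite pnatr_eq0.
move: h2; rewrite -!natr1 => h2.
by field; rewrite h1 h2.
Qed.

End Pochhammer.

(** Taylor coefficients of (1 - s / b) ^- n. *)
Definition binom_coef (R : realType) (n : nat) (b : R) (k : nat) : R :=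
  pochhammer n%:R k / (k`!%:R * b ^+ k).

Section PartialFractions.
Variable R : realType.

Lemma binom_coef0 n (b : R) : binom_coef n b 0 = 1.
Proof. by rewrite /binom_coef pochhammer0 mul1r mulr1 invr1. Qed.

Lemma binom_coefS n (b : R) k : b != 0 ->
  binom_coef n b k.+1 = binom_coef n.+1 b k.+1 - binom_coef n.+1 b k / b.
Proof.
move=> b0; rewrite /binom_coef [pochhammer n%:R _]pochhammerSl natr1.
rewrite [pochhammer n.+1%:R k.+1]pochhammerS factS natrM exprS.
have h1 := factS_neq0 R k.
have h2 : k.+1%:R != 0 :> R by rewrite pnatr_eq0.
have hb : b ^+ k != 0 by rewrite expf_neq0.
move: h2; rewrite -!natr1 => h2.
field; by rewrite h2 hb b0 h1.
Qed.

(** Multiplying (1 - s / b) ^- n.+1 by 1 - s / b lowers the exponent; the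
    factor - b avoids a denominator. *)
Lemma binom_series_step M n (b : R) : b != 0 ->
  eqmodX M (('X - b%:P) * series_poly M (binom_coef n.+1 b))
           ((- b) *: series_poly M (binom_coef n b)).
Proof.
move=> b0 [|k] kM; rewrite mulrBl coefB coefXM coefCM coefZ.
  by rewrite /= !coef_series_poly // /binom_coef !pochhammer0; ring.
have kM' := ltnW kM.
rewrite /= !coef_series_poly // (binom_coefS n k b0); field; exact: b0.
Qed.

Variables (p : nat) (c : 'I_p -> R) (c_inj : injective c) (M : nat).

(** The sum of the residues of f(t) / prod_q (t - c_q) ^ n_q at the c_q: the
    i-th summand is the coefficient of s ^ (n_i - 1) in the expansion of
    f(c_i + s) / prod_(q != i) (c_i - c_q + s) ^ n_q, and the extra factor 'X
    makes it vanish if n_i = 0. *)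
Definition residue_sum (n : 'I_p -> nat) (f : {poly R}) : R :=
  \sum_i ('X * ((f \Po ('X + (c i)%:P)) *
       \prod_(q | q != i) series_poly M (binom_coef (n q) (c q - c i))))`_(n i)
     / \prod_(q | q != i) (c i - c q) ^+ n q.

Definition decr (n : 'I_p -> nat) (q : 'I_p) : 'I_p -> nat :=
  fun r => (n r - (r == q))%N.

Lemma residue_sumD n f g :
  residue_sum n (f + g) = residue_sum n f + residue_sum n g.
Proof.
rewrite /residue_sum -big_split /=; apply: eq_bigr => i _.
by rewrite comp_polyD mulrDl mulrDr coefD mulrDl.
Qed.

Lemma residue_sumZ n a f : residue_sum n (a *: f) = a * residue_sum n f.
Proof.
rewrite /residue_sum mulr_sumr; apply: eq_bigr => i _.
by rewrite comp_polyZ -scalerAl -scalerAr coefZ -!mulrA.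
Qed.

(** At c_q itself the numerator t - c_q shifts the expansion by one power of s;
    at the other nodes it cancels against a denominator by
    binom_series_step. *)
Lemma residue_sum_cancel n q f : (forall i, n i <= M)%N -> (0 < n q)%N ->
  residue_sum n (('X - (c q)%:P) * f) = residue_sum (decr n q) f.
Proof.
move=> nM nq; apply: eq_bigr => i _.
rewrite comp_polyM comp_polyB comp_polyX comp_polyC -addrA -polyCB.
have [->|iq] := eqVneq i q.
  rewrite subrr addr0 -mulrA coefXM (negbTE (lt0n_neq0 nq)) /decr eqxx subn1.
  congr (('X * (_ * _))`_ _ / _).
    by apply: eq_bigr => r /negbTE ->; rewrite subn0.
  by apply: eq_bigr => r /negbTE ->; rewrite subn0.
have ci : c i - c q != 0 by rewrite subr_eq0 (inj_eq c_inj).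
have -> : decr n q i = n i by rewrite /decr (negbTE iq) subn0.
have splitq (T : comNzRingType) (F : 'I_p -> T) :
    \prod_(r | r != i) F r = F q * \prod_(r | (r != i) && (r != q)) F r.
  by rewrite (bigD1 q) // eq_sym.
rewrite !splitq.
have -> : decr n q q = (n q).-1 by rewrite /decr eqxx subn1.
have -> : \prod_(r | (r != i) && (r != q))
     series_poly M (binom_coef (decr n q r) (c r - c i)) =
   \prod_(r | (r != i) && (r != q))
     series_poly M (binom_coef (n r) (c r - c i)).
  by apply: eq_bigr => r /andP[_ /negbTE rq]; rewrite /decr rq subn0.
have -> : \prod_(r | (r != i) && (r != q)) (c i - c r) ^+ decr n q r =
   \prod_(r | (r != i) && (r != q)) (c i - c r) ^+ n r.
  by apply: eq_bigr => r /andP[_ /negbTE rq]; rewrite /decr rq subn0.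
set P := \prod_(r | _) series_poly _ _; set D := \prod_(r | _) _ ^+ _.
set fi := f \Po _.
case: (n q) nq => // m _ /=.
set U := series_poly _ _; set V := series_poly _ _.
have UV : eqmodX M (('X + (c i - c q)%:P) * U) ((c i - c q) *: V).
  have qi : c q - c i != 0 by rewrite -oppr_eq0 opprB.
  by have := @binom_series_step M m _ qi; rewrite -polyCN !opprB.
have -> : ('X * (('X + (c i - c q)%:P) * fi * (U * P)))`_(n i) =
          (c i - c q) * ('X * (fi * (V * P)))`_(n i).
  have E : eqmodX M ((('X + (c i - c q)%:P) * fi * (U * P)))
                  ((c i - c q) *: (fi * (V * P))).
    have -> : ('X + (c i - c q)%:P) * fi * (U * P) =
        (('X + (c i - c q)%:P) * U) * (fi * P) by ring.
    have -> : (c i - c q) *: (fi * (V * P)) = ((c i - c q) *: V) * (fi * P).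
      by rewrite -!mul_polyC; ring.
    exact: eqmodX_mulr.
  rewrite !coefXM; have := nM i; case: (n i) => [|k] kM /=; first by rewrite mulr0.
  by rewrite E // coefZ.
rewrite exprS -mulrA invfM; case: (eqVneq D 0) => [->|D0].
  by rewrite mulr0 !invr0 !mulr0.
by field; rewrite ci D0 expf_neq0.
Qed.

Lemma vsize_gt0 n : (0 < vsize n)%N -> exists q : 'I_p, (0 < n q)%N.
Proof.
move=> n_gt0; apply: contrapT => H; move: n_gt0.
rewrite /vsize big1 // => i _; apply/eqP; rewrite -leqn0 leqNgt.
by apply/negP => ni; apply: H; exists i.
Qed.

Lemma vsize_decr n q : (0 < n q)%N -> vsize n = (vsize (decr n q)).+1.
Proof.
move=> nq; rewrite /vsize (bigD1 q) //= [in RHS](bigD1 q) //= {1}/decr eqxx.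
rewrite -addSn subn1 prednK //; congr (_ + _)%N.
by apply: eq_bigr => r /negbTE rq; rewrite /decr rq subn0.
Qed.

(** The residue theorem on the Riemann sphere for a quotient of degree at most
    -1: the finite residues sum up to the coefficient of 1 / t at infinity.
    Dividing f by t - c_q lowers |n|, so that only f = 1 matters; there two
    different factors t - c_q and t - c_r differ by a constant. *)
Lemma residue_sumE n (f : {poly R}) : (forall i, n i <= M)%N -> (0 < vsize n)%N ->
  (size f <= vsize n)%N -> residue_sum n f = f`_(vsize n).-1.
Proof.
move: {2}(vsize n).-1 (erefl (vsize n).-1) => N.
elim: N n f => [|N IH] n f nN nM n_gt0 fn.
  have [q nq] := vsize_gt0 n_gt0.
  have n1 : vsize n = 1%N by move: nN n_gt0; case: (vsize n) => [|[]].
  have nq1 : n q = 1%N.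
    move: n1; rewrite /vsize (bigD1 q) //=; case: (n q) nq => // k _.
    by rewrite addSn => -[] /eqP; rewrite addn_eq0 => /andP[/eqP->].
  have n0 r : r != q -> n r = 0%N.
    move=> rq; move: n1; rewrite /vsize (bigD1 q) //= nq1 => -[] /eqP.
    by rewrite sum_nat_eq0 => /forallP /(_ r) /implyP /(_ rq) /eqP.
  have [a ->] : exists a, f = a%:P.
    by exists f`_0; apply: size1_polyC; rewrite -n1.
  rewrite n1 coefC /= /residue_sum (bigD1 q) //= [X in _ + X]big1 ?addr0; last first.
    by move=> i iq; rewrite (n0 i iq) coefXM /= mul0r.
  rewrite nq1 coefXM /= comp_polyC coefCM.
  rewrite [X in _ / X]big1 => [|r rq]; last by rewrite n0.
  rewrite divr1 -horner_coef0 horner_prod big1 ?mulr1 // => r rq.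
  rewrite horner_coef0 coef_series_poly ?(leq_trans _ (nM q)) ?nq1 //.
  exact: binom_coef0.
have nS : vsize n = N.+2 by move: nN n_gt0; case: (vsize n) => //= k ->.
have [q nq] := vsize_gt0 n_gt0.
have decrM r : (forall i, decr n r i <= M)%N.
  by move=> i; apply: leq_trans (nM i); exact: leq_subr.
have decr_size r : (0 < n r)%N -> vsize (decr n r) = N.+1.
  by move=> nr; move: (vsize_decr nr); rewrite nS => -[].
have res1 : residue_sum n 1 = 0.
  have [/existsP[r /andP[rq nr]]|/existsPn nex] :=
    boolP [exists r, (r != q) && (0 < n r)%N].
    have cqr : c r - c q != 0 by rewrite subr_eq0 (inj_eq c_inj).
    apply: (mulfI cqr); rewrite mulr0 -residue_sumZ.
    have -> : (c r - c q) *: 1 =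
      ('X - (c q)%:P) * 1 + (-1) *: (('X - (c r)%:P) * 1) :> {poly R}.
      by rewrite -!mul_polyC !mulr1 polyCB polyCN; ring.
    rewrite residue_sumD residue_sumZ !residue_sum_cancel //.
    by rewrite !IH ?decr_size ?size_poly1 //; ring.
  have n0 r : r != q -> n r = 0%N.
    by move=> rq; have := nex r; rewrite rq /= lt0n negbK => /eqP.
  have nqN : n q = N.+2.
    by rewrite -nS /vsize (bigD1 q) //= big1 ?addn0.
  rewrite /residue_sum (bigD1 q) //= [X in _ + X]big1 ?addr0; last first.
    by move=> i iq; rewrite (n0 i iq) coefXM /= mul0r.
  rewrite comp_polyC mul1r nqN coefXM /=.
  have -> : (\prod_(r | r != q) series_poly M (binom_coef (n r) (c r - c q)))`_N.+1
          = (1 : {poly R})`_N.+1.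
    have NM : (N.+1 < M)%N by rewrite -nqN.
    transitivity ((\prod_(r : 'I_p | r != q) (1 : {poly R}))`_N.+1); last first.
      by rewrite big1.
    apply: (@eqmodX_prod _ _ _ _ M) => // r rq k kM.
    rewrite coef_series_poly // n0 // coef1.
    case: k kM => [|k] _; first exact: binom_coef0.
    by rewrite /binom_coef pochhammerSl !mul0r.
  by rewrite coef1 mul0r.
have [g [a fE]] : exists g a, f = a%:P + ('X - (c q)%:P) * g.
  exists (f %/ ('X - (c q)%:P)), f.[c q].
  by rewrite addrC mulrC {1}(divp_eq f ('X - (c q)%:P)) modp_XsubC.
have sg : (size g <= N.+1)%N.
  have [->|g0] := eqVneq g 0; first by rewrite size_poly0.
  have := fn; rewrite nS fE addrC size_polyDl.
    by rewrite size_monicM ?monicXsubC // size_XsubC.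
  rewrite size_monicM ?monicXsubC // size_XsubC /=.
  by apply: leq_ltn_trans (size_polyC_leq1 _) _; rewrite ltnS size_poly_gt0.
rewrite {1}fE residue_sumD residue_sum_cancel // (IH (decr n q)) ?decr_size //.
have -> : a%:P = a *: 1 :> {poly R} by rewrite -mul_polyC mulr1.
rewrite residue_sumZ res1 mulr0 add0r nS fE /= coefD coefC add0r.
by rewrite mulrBl coefB coefXM coefCM /= (nth_default _ sg) mulr0 subr0.
Qed.

End PartialFractions.

(** * Hermite polynomials as Taylor coefficients *)

Section HermiteSeries.
Variable R : realType.
Implicit Types (c x : R) (j k m M : nat).

(** Taylor coefficients of exp(- s ^ 2 / 4 - c s / 2), by the generating function
    of the Hermite polynomials; see hermite_coefE. *)
Definition hermite_coef c k : R := (-1) ^+ k * (hermite R k).[c / 2] / k`!%:R.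

(** Taylor coefficients of exp(- s ^ 2 / 4). *)
Let even_coef k : R := if odd k then 0 else (- (1 / 4)) ^+ k./2 / k./2`!%:R.

Lemma sum_even_terms (F : nat -> R) n : (forall k, odd k -> F k = 0) ->
  \sum_(k < n.+1) F k = \sum_(k < n./2.+1) F k.*2.
Proof.
move=> F0; elim: n => [|n IH]; first by rewrite !big_ord1.
rewrite big_ord_recr /= IH uphalf_half; case: (boolP (odd n)) => on /=.
  rewrite add1n [RHS]big_ord_recr /=; congr (_ + F _).
  by rewrite -[in LHS](odd_double_half n) on /= doubleS.
by rewrite add0n F0 ?addr0 //= on.
Qed.

Lemma hermite_coefE c n :
  hermite_coef c n = \sum_(j < n.+1) even_coef j * exp_coeff (- (c / 2)) (n - j)%N.
Proof.
rewrite (sum_even_terms (F := fun j => even_coef j * exp_coeff (- (c / 2)) (n - j)%N)).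
  rewrite /hermite_coef /hermite horner_sum mulr_sumr mulr_suml.
  apply: eq_bigr => -[k /=]; rewrite ltnS => kn _.
  have k2n : (k.*2 <= n)%N by rewrite -geq_half_double.
  rewrite hornerZ hornerXn pochhammer_oppn // /even_coef odd_double doubleK.
  rewrite /exp_coeff /= [(- (c / 2)) ^+ _]exprNn.
  have -> : (-1) ^+ n = (-1) ^+ (n - k.*2) :> R.
    by rewrite -[RHS]signr_odd oddB // odd_double addbF signr_odd.
  have -> : (-1) ^+ k.*2 = 1 :> R by rewrite -signr_odd odd_double.
  have -> : 2 ^+ k.*2 = 4 ^+ k :> R by rewrite -mul2n exprM -natrX.
  have -> : (- (1 / 4)) ^+ k = (-1) ^+ k / 4 ^+ k :> R.
    by rewrite [LHS]exprNn expr_div_n expr1n mul1r.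
  have h1 := factS_neq0 R k; have h2 := factS_neq0 R n.
  have h3 := factS_neq0 R (n - k.*2).
  by field; rewrite h1 h2 h3 /= expf_neq0 ?pnatr_eq0.
by move=> k ok; rewrite /even_coef ok mul0r.
Qed.


Lemma even_coefS k : even_coef k.+2 *+ k.+2 = - (1 / 2) * even_coef k.
Proof.
rewrite /even_coef /= negbK; case: (boolP (odd k)) => ok; first by rewrite mul0rn mulr0.
have kE : k.+2%:R = 2 * k./2.+1%:R :> R.
  by rewrite -natrM mul2n doubleS -[in LHS](odd_double_half k) (negbTE ok).
rewrite -[LHS]mulr_natr kE factS exprS natrM.
have h1 := factS_neq0 R k./2.
have h2 : 1 + k./2%:R != 0 :> R by rewrite addrC natr1 pnatr_eq0.
by field; rewrite h1 h2.
Qed.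

Lemma even_coef_deriv M :
  eqmodX M (series_poly M.+1 even_coef)^`()
           (- ((1 / 2) *: 'X) * series_poly M.+1 even_coef).
Proof.
move=> [|k] kM; rewrite coef_deriv coef_series_poly // mulNr coefN -scalerAl.
  by rewrite coefZ coefXM /= mulr0 oppr0 mul0rn.
rewrite even_coefS coefZ coefXM /= coef_series_poly ?mulNr //.
exact: ltn_trans (ltnW kM) _.
Qed.

Lemma exp_series_deriv M x :
  eqmodX M (series_poly M.+1 (exp_coeff x))^`()
           (x *: series_poly M.+1 (exp_coeff x)).
Proof.
move=> k kM; rewrite coef_deriv coefZ !coef_series_poly //; last exact: ltnW.
rewrite /exp_coeff /= factS exprS natrM -[LHS]mulr_natr.
have h1 := factS_neq0 R k.
have h2 : 1 + k%:R != 0 :> R by rewrite addrC natr1 pnatr_eq0.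
by field; rewrite h1 h2.
Qed.

Lemma hermite_series_factor M c :
  eqmodX M (series_poly M (hermite_coef c))
    (series_poly M even_coef * series_poly M (exp_coeff (- (c / 2)))).
Proof.
move=> k kM; rewrite coef_series_poly // hermite_coefE coefM.
apply: eq_bigr => -[j /=]; rewrite ltnS => jk _.
rewrite !coef_series_poly //; first exact: leq_ltn_trans (leq_subr _ _) kM.
exact: leq_ltn_trans jk kM.
Qed.

(** The differential equation B' = - (c + s) / 2 * B of the exponential. *)
Lemma hermite_series_deriv M c :
  eqmodX M (series_poly M.+1 (hermite_coef c))^`()
           (- ((1 / 2) *: ('X + c%:P)) * series_poly M.+1 (hermite_coef c)).
Proof.
set D := series_poly M.+1 even_coef; set E := series_poly M.+1 (exp_coeff (- (c / 2))).
have BDE := @hermite_series_factor M.+1 c.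
have BDE' : eqmodX M (series_poly M.+1 (hermite_coef c)) (D * E).
  by move=> k kM; apply: BDE; exact: ltnW.
apply: eqmodX_trans (eqmodX_deriv BDE) _; rewrite derivM.
apply: eqmodX_trans (eqmodX_mull _ (eqmodX_sym BDE')).
have -> : - ((1 / 2) *: ('X + c%:P)) * (D * E) =
    (- ((1 / 2) *: 'X) * D) * E + D * ((- (c / 2)) *: E).
  by rewrite -!mul_polyC polyCN !polyCM polyC1; ring.
apply: eqmodX_add; first exact: eqmodX_mulr (@even_coef_deriv M).
exact: eqmodX_mull (@exp_series_deriv M _).
Qed.

Lemma hermite_coef0 c : hermite_coef c 0 = 1.
Proof.
by rewrite hermite_coefE big_ord1 /even_coef /exp_coeff /= !divr1 mulr1 expr0.
Qed.

Lemma hermite_coef1 c : hermite_coef c 1 = - (c / 2).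
Proof.
have := @hermite_series_deriv 1 c 0%N isT.
rewrite coef_deriv coef_series_poly // mulr1n => ->.
rewrite mulNr coefN -scalerAl coefZ mulrDl coefD coefXM coefCM /=.
by rewrite coef_series_poly // hermite_coef0; field.
Qed.

Lemma hermite_coefS c k : k.+2%:R * hermite_coef c k.+2 =
  - (c / 2) * hermite_coef c k.+1 - hermite_coef c k / 2.
Proof.
have := @hermite_series_deriv k.+2 c k.+1 (leqnn _).
rewrite coef_deriv coef_series_poly // mulr_natl => ->.
rewrite mulNr coefN -scalerAl coefZ mulrDl coefD coefXM coefCM /=.
have k3 : (k < k.+3)%N by rewrite ltnS (leqW (leqnSn k)).
by rewrite !coef_series_poly //; field.
Qed.

(** The polynomials h_j with (d / dt) ^ j exp(t ^ 2 / 4) = h_j(t) exp(t ^ 2 / 4). *)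
Fixpoint gauss_poly j : {poly R} :=
  if j is j'.+1 then (gauss_poly j')^`() + (1 / 2) *: ('X * gauss_poly j') else 1.

(** Taylor coefficients at t = c of h_j(t) exp(t ^ 2 / 4), divided by
    exp(c ^ 2 / 4). *)
Definition gauss_taylor M c j : {poly R} :=
  series_poly M (fun k => (gauss_poly (j + k)).[c] / k`!%:R).

(** Taylor's formula for h_j(t) exp((t ^ 2 - c ^ 2) / 4), whose k-th derivative
    is h_(j + k)(t) exp((t ^ 2 - c ^ 2) / 4), multiplied by
    exp((c ^ 2 - t ^ 2) / 4) = exp(- c s / 2 - s ^ 2 / 4) with t = c + s. Both
    sides have the same constant term, and the derivative of either side for j
    is its value for j + 1 minus (c + s) / 2 times its value for j. *)
Lemma gauss_taylorE M c j :
  eqmodX M (gauss_taylor M c j * series_poly M (hermite_coef c))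
           (gauss_poly j \Po ('X + c%:P)).
Proof.
set B := series_poly M (hermite_coef c).
suff H m : (m <= M)%N -> forall j, eqmodX m (gauss_taylor M c j * B)
           (gauss_poly j \Po ('X + c%:P)) by exact: H.
elim: m => [//|m IH] mM {}j [|k] km.
  rewrite -!horner_coef0 hornerM horner_comp !horner_coef0.
  have M0 : (0 < M)%N by exact: leq_trans mM.
  rewrite /B /gauss_taylor !coef_series_poly // hermite_coef0 addn0 mulr1 divr1.
  by rewrite coefD coefX coefC /= add0r.
case: M mM @B IH => // M mM B IH; rewrite ltnS in km.
have k0 : k.+1%:R != 0 :> R by rewrite pnatr_eq0.
apply: (mulIf k0); rewrite !mulr_natr -!coef_deriv.
have AB : eqmodX m (gauss_taylor M.+1 c j * B)^`()
   (gauss_taylor M.+1 c j.+1 * B - (1 / 2) *: ('X + c%:P) * (gauss_taylor M.+1 c j * B)).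
  have -> : gauss_taylor M.+1 c j.+1 * B - (1 / 2) *: ('X + c%:P) * (gauss_taylor M.+1 c j * B)
    = gauss_taylor M.+1 c j.+1 * B +
      gauss_taylor M.+1 c j * (- ((1 / 2) *: ('X + c%:P)) * B) by ring.
  rewrite derivM; apply: eqmodX_add.
    apply: eqmodX_mulr => i im; have iM := leq_trans im mM.
    rewrite coef_deriv !coef_series_poly //; last exact: ltnW.
    rewrite addnS factS natrM -[LHS]mulr_natr addSn.
    have h1 := factS_neq0 R i.
    have h2 : 1 + i%:R != 0 :> R by rewrite addrC natr1 pnatr_eq0.
    by field; rewrite h1 h2.
  apply: eqmodX_mull => i im; apply: hermite_series_deriv.
  exact: leq_trans im mM.
rewrite AB // coefB (IH (ltnW mM)) // -(eqmodX_mull _ (eqmodX_sym (IH (ltnW mM) j))) //.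
rewrite -coefB; congr (_`_k).
rewrite /= comp_polyD comp_polyZ comp_polyM comp_polyX deriv_comp derivD derivX derivC.
by rewrite addr0 mulr1 -scalerAl addrK.
Qed.

End HermiteSeries.

(** * Integrals dominated by K / (1 + x ^ 2) *)

Section Dominated.
Variable R : realType.
Let mu := @lebesgue_measure R.
Implicit Types (f : R -> R) (K : R).

Lemma integrable_oneDsqrV :
  mu.-integrable [set: R] (EFin \o (fun x : R => (oneDsqr x)^-1)).
Proof.
have c1 : continuous (fun x : R => (oneDsqr x)^-1) by exact: continuous_oneDsqrV.
have p1 (x : R) : 0 <= (oneDsqr x)^-1 by rewrite invr_ge0 (le_trans ler01).
have m1 : measurable_fun [set: R] (fun x : R => (oneDsqr x)^-1).
  exact: continuous_measurable_fun.
apply/integrableP; split; first exact/measurable_EFinP.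
apply/abse_integralP => //=; first exact/measurable_EFinP.
rewrite ge0_symfun_integralT //; last by move=> x /=; rewrite /oneDsqr sqrrN.
rewrite (_ : [set x | _] = `[0, +oo[%classic); last first.
  by apply/seteqP; split => x/=; rewrite in_itv/= andbT.
by rewrite integral0y_oneDsqr -EFinM abse_EFin ltry.
Qed.

Lemma integrable_oneDsqrV_mul K :
  mu.-integrable [set: R] (EFin \o (fun x : R => K / oneDsqr x)).
Proof. exact: (integrableZl measurableT K integrable_oneDsqrV). Qed.

(** Gaussian moments and the integrand of Stirling's formula both admit a bound
    of this form, whose integral is known through the arctangent. *)
Lemma integrable_dominated f K : measurable_fun [set: R] f ->
  (forall x, `|f x| <= K / oneDsqr x) -> mu.-integrable [set: R] (EFin \o f).
Proof.
move=> mf fK; apply: (le_integrable measurableT _ _ (integrable_oneDsqrV_mul K)).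
  exact/measurable_EFinP.
by move=> x _ /=; rewrite lee_fin (le_trans (fK x)) // ler_norm.
Qed.

Lemma Rintegral_dominated_cvg (f_ : nat -> R -> R) f K :
  (forall n, measurable_fun [set: R] (f_ n)) -> measurable_fun [set: R] f ->
  (\forall n \near \oo, forall x, `|f_ n x| <= K / oneDsqr x) ->
  (forall x, f_ n x @[n --> \oo] --> f x) ->
  \int[mu]_x f_ n x @[n --> \oo] --> \int[mu]_x f x.
Proof.
move=> mf_ mf [N _ fK] ff.
rewrite -(cvg_shiftn N).
have fbd x : `|f x| <= K / oneDsqr x.
  have := ff x; move/cvg_norm => ffx.
  apply: (cvgr_to_le ffx).
  by exists N => // n /= Nn; exact: fK.
apply: fine_cvg; rewrite fineK; last first.
  by apply: integrable_fin_num => //; exact: integrable_dominated mf fbd.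
apply: (dominated_cvg measurableT _ _ _ (integrable_oneDsqrV_mul K)) => //=.
- by move=> n; apply/measurable_EFinP; exact: mf_.
- by move=> x _; apply: cvg_EFin; [exact: nearW|rewrite (cvg_shiftn N (f_ ^~ x)); exact: ff].
- by move=> n x _; rewrite lee_fin; apply: fK => /=; exact: leq_addl.
Qed.

End Dominated.

(** * Auxiliary limits and Gaussian integrals *)

Section AuxiliaryLimits.
Variable R : realType.

Lemma cvg_sqrt_pinfty (T : Type) (F : set_system T) (FF : Filter F) (b : T -> R) :
  b @ F --> +oo -> (fun z => Num.sqrt (b z)) @ F --> +oo.
Proof.
move=> /cvgryPge bF; apply/cvgryPge => A.
near=> z; have [A0|A0] := ltP A 0.
  by rewrite (le_trans (ltW A0)) ?sqrtr_ge0.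
rewrite -[A]ger0_norm // -sqrtr_sqr ler_wsqrtr //.
by near: z; exact: bF.
Unshelve. all: by end_near. Qed.

Lemma cvg_inv_pinfty (T : Type) (F : set_system T) (FF : Filter F) (b : T -> R) :
  b @ F --> +oo -> (fun z => (b z)^-1) @ F --> (0 : R).
Proof.
move=> bF; apply/gtr0_cvgV0 => //; by move/cvgryPgt : bF; apply.
Qed.

Lemma cvg_exprn (T : Type) (F : set_system T) (FF : Filter F) (f : T -> R) (l : R) n :
  f @ F --> l -> (fun z => f z ^+ n) @ F --> l ^+ n.
Proof.
move=> fl; elim: n => [|n IH]; first exact: cvg_cst.
under eq_fun do rewrite exprS.
by rewrite exprS; exact: cvgM.
Qed.

End AuxiliaryLimits.

Section GaussianIntegral.
Variable R : realType.
Let mu := @lebesgue_measure R.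

Lemma integrable_normal_fun m (s : R) : s != 0 ->
  mu.-integrable [set: R] (EFin \o normal_fun m s).
Proof.
move=> s0; have := integrableZl measurableT (normal_peak s)^-1 (integrable_normal_pdf m s).
apply: eq_integrable => // x _ /=.
rewrite /normal_pdf (negbTE s0).
by rewrite -EFinM mulKf // gt_eqF // normal_peak_gt0.
Qed.

Lemma Rintegral_normal_fun m (s : R) : s != 0 ->
  \int[mu]_x normal_fun m s x = (normal_peak s)^-1.
Proof.
move=> s0; have p0 : normal_peak s != 0 by rewrite gt_eqF // normal_peak_gt0.
apply: (mulfI p0); rewrite divff // -RintegralZl //; last exact: integrable_normal_fun.
have := integral_normal_pdf m s; rewrite /normal_pdf (negbTE s0) => H.
by rewrite /Rintegral H.
Qed.

End GaussianIntegral.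

(** * Moments of the weights *)

Section Moments.
Variable R : realType.
Let mu := @lebesgue_measure R.
Implicit Types (c x K : R) (m : nat).

Lemma exprn_le_expR (x : R) k : 0 <= x -> x ^+ k <= k`!%:R * expR x.
Proof.
move=> x0; have kf : 0 < k`!%:R :> R by rewrite ltr0n fact_gt0.
rewrite mulrC -ler_pdivrMr //; case: k kf => [|k] kf.
  by rewrite expr0 divr1; have := expR_ge1Dx x; lra.
by have := expR_ge1Dxn k x0; lra.
Qed.

Definition weight_mon c m x : R := x ^+ m * expR (- x ^+ 2 + c * x).

(** Bounds (1 + x ^ 2) |weight_mon c m x|, by |x| ^ k <= k! exp |x| and
    completion of the square. *)
Definition weight_bound c m : R :=
  (m`!%:R + m.+2`!%:R) * expR ((1 + `|c|) ^+ 2 / 4).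

Lemma weight_mon_le c m x : `|weight_mon c m x| <= weight_bound c m / oneDsqr x.
Proof.
have one0 : 0 < oneDsqr x by rewrite (lt_le_trans ltr01).
rewrite ler_pdivlMr // /weight_mon normrM normrX (ger0_norm (expR_ge0 _)).
have x2 : x ^+ 2 = `|x| ^+ 2 by rewrite real_normK ?num_real.
have cx : c * x <= `|c| * `|x| by rewrite -normrM ler_norm.
have -> : `|x| ^+ m * expR (- x ^+ 2 + c * x) * oneDsqr x =
   (`|x| ^+ m + `|x| ^+ m.+2) * expR (- x ^+ 2 + c * x).
  by rewrite /oneDsqr x2 !exprS; ring.
have b1 : `|x| ^+ m + `|x| ^+ m.+2 <= (m`!%:R + m.+2`!%:R) * expR `|x|.
  by rewrite mulrDl lerD // exprn_le_expR.
apply: (le_trans (ler_wpM2r (expR_ge0 _) b1)).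
rewrite -mulrA -expRD ler_wpM2l ?addr_ge0 // ler_expR x2.
by have := sqr_ge0 (`|x| - (1 + `|c|) / 2); nra.
Qed.

Lemma is_derive_weight_mon c m x : is_derive x 1 (weight_mon c m)
  (m%:R * weight_mon c m.-1 x + c * weight_mon c m x - 2 * weight_mon c m.+1 x).
Proof.
elim: m => [|m IH].
  have d1 : is_derive x 1 (fun x : R => - x ^+ 2 + c * x) (- 2 * x + c).
    by apply: is_derive_eq; rewrite /GRing.scale /=; ring.
  have -> : weight_mon c 0 = expR \o (fun x : R => - x ^+ 2 + c * x).
    by apply/funext => y; rewrite /weight_mon expr0 mul1r.
  have d2 : is_derive x 1 (expR \o (fun x : R => - x ^+ 2 + c * x))
       (expR (- x ^+ 2 + c * x) * (- 2 * x + c)).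
    exact: is_derive1_comp.
  by apply: is_derive_eq; rewrite /weight_mon /= ?expr0 ?expr1; ring.
have -> : weight_mon c m.+1 = id * weight_mon c m.
  by apply/funext => y; rewrite mulrfctE /weight_mon exprS mulrA.
apply: is_derive_eq; rewrite /GRing.scale /= mulrfctE -natr1.
by case: m {IH} => [|m] /=; rewrite /weight_mon !exprS ?expr0 -?natr1; ring.
Qed.

Lemma continuous_weight_mon c m : continuous (weight_mon c m).
Proof.
move=> x; apply/differentiable_continuous/derivable1_diffP.
by case: (is_derive_weight_mon c m x).
Qed.

Lemma measurable_weight_mon c m : measurable_fun [set: R] (weight_mon c m).
Proof. by apply: continuous_measurable_fun; exact: continuous_weight_mon. Qed.

Lemma integrable_weight_mon c m : mu.-integrable [set: R] (EFin \o weight_mon c m).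
Proof.
apply: integrable_dominated (measurable_weight_mon c m) _.
exact: weight_mon_le.
Qed.

(** The fundamental theorem of calculus on [- n, n], where the boundary terms
    tend to 0, and dominated convergence. *)
Lemma Rintegral_derive_eq0 (F f : R -> R) K :
  (forall x, is_derive x 1 F (f x)) -> continuous f ->
  (forall x, `|F x| <= K / oneDsqr x) -> (forall x, `|f x| <= K / oneDsqr x) ->
  \int[mu]_x f x = 0.
Proof.
move=> dF cf FK fK.
have cF : continuous F.
  by move=> u; apply/differentiable_continuous/derivable1_diffP; case: (dF u).
have mf : measurable_fun [set: R] f by exact: continuous_measurable_fun.
have K0 : 0 <= K.
  have := le_trans (normr_ge0 _) (FK 0).
  by rewrite /oneDsqr expr0n addr0 divr1.
pose fn (n : nat) := f \_ `[- n%:R, n%:R].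
have lim1 : \int[mu]_x fn n x @[n --> \oo] --> \int[mu]_x f x.
  apply: (@Rintegral_dominated_cvg _ _ _ K) => //.
  - by move=> n; apply/measurable_restrict => //; exact: measurable_funTS.
  - apply: nearW => n x; rewrite /fn patchE; case: ifP => _ //.
    by rewrite normr0; apply: le_trans (FK x).
  - move=> x; apply: cvg_near_cst; near=> n.
    rewrite /fn patchE mem_set //= in_itv /= -ler_norml.
    by near: n; exact: nbhs_infty_ger.
have intE n : \int[mu]_x fn n.+1 x = F n.+1%:R - F (- n.+1%:R).
  rewrite /fn -Rintegral_mkcond /Rintegral (continuous_FTC2 (F := F)) //.
  - by rewrite -subr_gt0 opprK -natrD ltr0n.
  - by apply: continuous_subspaceT.
  - split; [|by apply: cvg_at_right_filter; exact: cF|by apply: cvg_at_left_filter; exact: cF].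
    by move=> x _; case: (dF x).
  - by move=> x _; rewrite derive1E; case: (dF x).
have inv0 : (n%:R : R)^-1 @[n --> \oo] --> (0 : R).
  by apply: cvg_inv_pinfty; exact: cvgr_idn.
have b0 (s : nat -> R) : (forall n, `|s n| = n%:R) -> F (s n) @[n --> \oo] --> (0 : R).
  move=> sn; apply/cvgr0Pnorm_le => e e0.
  have Kinv : K * (n%:R)^-1 @[n --> \oo] --> (0 : R).
    by rewrite -(mulr0 K); apply: cvgM => //; exact: cvg_cst.
  have {}Kinv := (cvgr0Pnorm_le _).1 Kinv e e0.
  near=> n; have n0 : (0 < n)%N by near: n; exact: nbhs_infty_gt.
  apply: (@le_trans _ _ `|K * n%:R^-1|); last by near: n; exact: Kinv.
  apply: (le_trans (FK _)); rewrite [leRHS]ger0_norm ?mulr_ge0 ?invr_ge0 ?ler0n //.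
  rewrite ler_wpM2l // lef_pV2 ?posrE ?ltr0n // ?(lt_le_trans ltr01) //.
  rewrite /oneDsqr -[s n ^+ 2]real_normK ?num_real // sn.
  have : 1 <= n%:R :> R by rewrite ler1n.
  by nra.
have lim2 : \int[mu]_x fn n x @[n --> \oo] --> (0 : R).
  rewrite -(cvg_shiftS (fun n => \int[mu]_x fn n x)).
  have lim3 : F n%:R - F (- n%:R) @[n --> \oo] --> (0 : R).
    by rewrite -[0]subr0; apply: cvgB; apply: b0 => n; rewrite ?normrN normr_nat.
  move: lim3; rewrite -(cvg_shiftS (fun n : nat => F n%:R - F (- n%:R))) /=.
  by under [X in _ -> X @ _ --> _]eq_fun do rewrite intE.
by rewrite -(cvg_lim _ lim1) // -[RHS](cvg_lim _ lim2).
Unshelve. all: by end_near. Qed.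

(** The integral over the line of the derivative of x ^ m exp(- x ^ 2 + c x)
    vanishes. *)
Lemma weight_moment_rec c m :
  2 * \int[mu]_x weight_mon c m.+1 x =
  m%:R * \int[mu]_x weight_mon c m.-1 x + c * \int[mu]_x weight_mon c m x.
Proof.
have iw k := integrable_weight_mon c k.
have iZ a k : mu.-integrable [set: R] (EFin \o (fun x => a * weight_mon c k x)).
  exact: (integrableZl measurableT a (iw k)).
have iD : mu.-integrable [set: R] (EFin \o
    (fun x => m%:R * weight_mon c m.-1 x + c * weight_mon c m x)).
  exact: (integrableD measurableT (iZ _ _) (iZ _ _)).
have : \int[mu]_x (m%:R * weight_mon c m.-1 x + c * weight_mon c m x
    - 2 * weight_mon c m.+1 x) = 0.
  pose K := weight_bound c m + (m%:R * weight_bound c m.-1 +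
      `|c| * weight_bound c m + 2 * weight_bound c m.+1).
  have wb0 k : 0 <= weight_bound c k by rewrite mulr_ge0 ?addr_ge0 ?expR_ge0.
  have D0 x : 0 <= (oneDsqr x)^-1 by rewrite invr_ge0 (le_trans ler01).
  have K0 : 0 <= m%:R * weight_bound c m.-1 +
      `|c| * weight_bound c m + 2 * weight_bound c m.+1.
    by rewrite !addr_ge0 ?mulr_ge0.
  apply: (@Rintegral_derive_eq0 (weight_mon c m) _ K).
  - exact: is_derive_weight_mon.
  - move=> x; apply: cvgB; [apply: cvgD|]; apply: cvgM;
      by [exact: cvg_cst|exact: continuous_weight_mon].
  - move=> x; apply: (le_trans (weight_mon_le _ _ _)).
    by rewrite ler_wpM2r // lerDl.
  - move=> x; apply: (@le_trans _ _ ((m%:R * weight_bound c m.-1 +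
      `|c| * weight_bound c m + 2 * weight_bound c m.+1) / oneDsqr x)); last first.
      by rewrite ler_wpM2r // lerDr.
    rewrite (mulrDl (m%:R * weight_bound c m.-1 + _)).
    rewrite (mulrDl (m%:R * weight_bound c m.-1)).
    apply: (le_trans (ler_normB _ _)); apply: lerD.
      apply: (le_trans (ler_normD _ _)); apply: lerD.
        by rewrite normrM normr_nat -mulrA ler_wpM2l // weight_mon_le.
      by rewrite normrM -mulrA ler_wpM2l // weight_mon_le.
    by rewrite normrM normr_nat -mulrA ler_wpM2l // weight_mon_le.
rewrite RintegralB // RintegralD // !RintegralZl //.
by move/eqP; rewrite subr_eq0 => /eqP ->.
Qed.

Lemma deriv_gauss_poly m :
  (gauss_poly R m)^`() = (m%:R / 2) *: gauss_poly R m.-1.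
Proof.
elim: m => [|m IH] /=; first by rewrite derivC mul0r scale0r.
rewrite derivD derivZ derivM derivX mul1r scalerDr.
have -> : (gauss_poly R m)^`()^`() = (m%:R / 2) *: (gauss_poly R m.-1)^`().
  by rewrite IH derivZ.
case: m IH => [|m] /= IH.
  by rewrite !derivC mulr0 !scaler0 add0r addr0 mulr1 mul1r.
by rewrite IH -[m.+2%:R]natr1 -!mul_polyC !(polyCM, polyCD) ?polyC1; ring.
Qed.

(** The integral of exp(- x ^ 2 + c x) is sqrt(pi) exp(c ^ 2 / 4), and each
    derivative in c brings down a factor x. In place of a differentiation under
    the integral sign, both sides are seen to satisfy the recurrence
    weight_moment_rec. *)
Lemma weight_moment c m : \int[mu]_x weight_mon c m x =
  Num.sqrt pi * expR (c ^+ 2 / 4) * (gauss_poly R m).[c].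
Proof.
have M0 : \int[mu]_x weight_mon c 0 x = Num.sqrt pi * expR (c ^+ 2 / 4).
  pose s : R := Num.sqrt (1 / 2).
  have s2 : s ^+ 2 = 1 / 2 by rewrite sqr_sqrtr.
  have s0 : s != 0 by rewrite gt_eqF // sqrtr_gt0.
  have -> : Num.sqrt pi = \int[mu]_x normal_fun (c / 2) s x.
    by rewrite Rintegral_normal_fun // /normal_peak invrK s2; congr Num.sqrt; lra.
  rewrite mulrC -RintegralZl //; last exact: integrable_normal_fun.
  apply: eq_Rintegral => x _; rewrite /weight_mon expr0 mul1r /normal_fun s2 -expRD.
  by congr expR; lra.
elim/ltn_ind: m => -[|[|m]] IH.
- by rewrite M0 hornerC mulr1.
- have := weight_moment_rec c 0; rewrite mul0r add0r M0 /= => H.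
  by rewrite derivC mulr1 add0r hornerZ hornerX; lra.
have := weight_moment_rec c m.+1; rewrite [m.+1.-1]/= (IH m) // (IH m.+1) // => H.
have -> : gauss_poly R m.+2 =
  (gauss_poly R m.+1)^`() + (1 / 2) *: ('X * gauss_poly R m.+1) by [].
rewrite deriv_gauss_poly hornerD !hornerZ hornerM hornerX [m.+1.-1]/=.
by lra.
Qed.

Lemma size_gauss_poly m : (size (gauss_poly R m) <= m.+1)%N.
Proof.
elim: m => [|m IH] /=; first by rewrite size_poly1.
apply: (leq_trans (size_polyD _ _)); rewrite geq_max; apply/andP; split.
  by apply: (leq_trans (size_poly _ _)); apply: leq_trans (leq_pred _) _; exact: leqW.
apply: (leq_trans (size_scale_leq _ _)).
apply: (leq_trans (size_polyMleq _ _)); rewrite size_polyX /=.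
by rewrite ltnS.
Qed.

Lemma coef_gauss_poly m : (gauss_poly R m)`_m = (1 / 2) ^+ m.
Proof.
elim: m => [|m IH]; first by rewrite coef1.
rewrite /= coefD coefZ coefXM /= IH coef_deriv nth_default; last first.
  by apply: (leq_trans (size_gauss_poly m)); rewrite ltnS.
by rewrite mul0rn add0r exprS.
Qed.

End Moments.

(** * The type I multiple Hermite polynomials *)

Section MultipleHermite.
Variables (R : realType) (p : nat) (c : 'I_p -> R) (c_inj : injective c).
Variable n : 'I_p -> nat.
Let mu := @lebesgue_measure R.
Let N := vsize n.
Implicit Types (i q : 'I_p) (j k M : nat) (x : R).

Lemma le_vsize i : (n i <= vsize n)%N.
Proof. by rewrite /vsize (bigD1 i) //= leq_addr. Qed.

Lemma moment_poly (a : R) (P : {poly R}) M j : (size P <= M)%N ->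
  \int[mu]_(x in [set: R]) (x ^+ j * P.[x] * expR (- x ^+ 2 + a * x)) =
  Num.sqrt pi * expR (a ^+ 2 / 4) *
    \sum_(k < M) P`_k * (gauss_poly R (j + k)).[a].
Proof.
move=> PM.
have iZ k : mu.-integrable [set: R] (EFin \o (fun x => P`_k * weight_mon a (j + k) x)).
  exact: (integrableZl measurableT P`_k (integrable_weight_mon a (j + k))).
have E x : x ^+ j * P.[x] * expR (- x ^+ 2 + a * x) =
    \sum_(k < M) P`_k * weight_mon a (j + k) x.
  rewrite (horner_coef_wide x PM) mulr_sumr mulr_suml; apply: eq_bigr => k _.
  by rewrite /weight_mon exprD; ring.
under eq_Rintegral do rewrite E.
have H m : mu.-integrable [set: R]
     (EFin \o (fun x => \sum_(k < m) P`_k * weight_mon a (j + k) x)) /\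
   \int[mu]_x (\sum_(k < m) P`_k * weight_mon a (j + k) x) =
   Num.sqrt pi * expR (a ^+ 2 / 4) * \sum_(k < m) P`_k * (gauss_poly R (j + k)).[a].
  elim: m => [|m [IH1 IH2]].
    have -> : (fun x => \sum_(k < 0) P`_k * weight_mon a (j + k) x) = (fun=> 0).
      by apply/funext => x; rewrite big_ord0.
    by rewrite big_ord0 mulr0 Rintegral_cst // mul0r; split => //; exact: integrable0.
  have -> : (fun x => \sum_(k < m.+1) P`_k * weight_mon a (j + k) x) =
      (fun x => \sum_(k < m) P`_k * weight_mon a (j + k) x + P`_m * weight_mon a (j + m) x).
    by apply/funext => x; rewrite big_ord_recr.
  split; first exact: (integrableD measurableT IH1 (iZ m)).
  rewrite RintegralD // IH2 RintegralZl //; last exact: integrable_weight_mon.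
  by rewrite weight_moment big_ord_recr /=; ring.
by case: (H M).
Qed.

(** The expansion at t = c_i of everything but exp(t x) and the pole in the
    residue that defines H_i, up to constant factors. *)
Definition cofactor i : {poly R} := series_poly (n i) (hermite_coef (c i)) *
  \prod_(q | q != i) series_poly (n i) (binom_coef (n q) (c q - c i)).

Definition leading_factor i : R := 2 ^+ N.-1 / Num.sqrt pi *
  expR (- (c i ^+ 2 / 4)) / \prod_(q | q != i) (c i - c q) ^+ n q.

(** H_i is, up to a constant, the residue at t = c_i of
    exp(- t ^ 2 / 4 + (t - c_i) x) / prod_q (t - c_q) ^ n_q. *)
Definition hermiteI_sol : {ffun 'I_p -> {poly R}} := [ffun i =>
  leading_factor i *: \poly_(k < n i) ((cofactor i)`_((n i).-1 - k) / k`!%:R)].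

Lemma hermiteI_solE i x : (0 < n i)%N -> (hermiteI_sol i).[x] =
  leading_factor i * (series_poly (n i) (exp_coeff x) * cofactor i)`_(n i).-1.
Proof.
move=> ni; rewrite ffunE hornerZ horner_poly coefM; congr (_ * _).
rewrite -[in LHS](prednK ni); apply: eq_bigr => -[k /= kn] _.
rewrite coef_series_poly; last by rewrite -(prednK ni).
by rewrite /exp_coeff /=; ring.
Qed.

(** The i-th term of the j-th orthogonality condition is 2 ^ (N - 1) times the
    residue at c_i of h_j(t) / prod_q (t - c_q) ^ n_q: by gauss_taylorE the factor
    exp(- t ^ 2 / 4) of the solution turns the moments into h_j. *)
Lemma moment_sol i j :
  \int[mu]_(x in [set: R])
     (x ^+ j * (hermiteI_sol i).[x] * expR (- x ^+ 2 + c i * x)) =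
  2 ^+ N.-1 * (('X * ((gauss_poly R j \Po ('X + (c i)%:P)) *
       \prod_(q | q != i) series_poly N (binom_coef (n q) (c q - c i))))`_(n i)
     / \prod_(q | q != i) (c i - c q) ^+ n q).
Proof.
rewrite (@moment_poly _ _ (n i)); last first.
  by rewrite ffunE; apply: leq_trans (size_scale_leq _ _) (size_poly _ _).
have sp : Num.sqrt pi != 0 :> R by rewrite gt_eqF // sqrtr_gt0 pi_gt0.
case: (posnP (n i)) => [ni0|ni].
  by rewrite ni0 big_ord0 mulr0 coefXM /= mul0r mulr0.
have -> : \sum_(k < n i) (hermiteI_sol i)`_k * (gauss_poly R (j + k)).[c i] =
    leading_factor i * (gauss_taylor (n i) (c i) j * cofactor i)`_(n i).-1.
  rewrite coefM prednK // mulr_sumr; apply: eq_bigr => k _.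
  rewrite ffunE coefZ coef_poly ltn_ord coef_series_poly //; ring.
have -> : (gauss_taylor (n i) (c i) j * cofactor i)`_(n i).-1 =
   ('X * ((gauss_poly R j \Po ('X + (c i)%:P)) *
       \prod_(q | q != i) series_poly N (binom_coef (n q) (c q - c i))))`_(n i).
  rewrite coefXM (negbTE (lt0n_neq0 ni)) /cofactor mulrA.
  apply: (@eqmodX_mul _ (n i)); last by rewrite prednK.
    exact: gauss_taylorE.
  by apply: eqmodX_prod => q _; apply: eqmodX_series; exact: le_vsize.
rewrite /leading_factor; set D := \prod_(q | _) _ ^+ _; set P := (polyseq _)`_(n i).
have e0 : expR (c i ^+ 2 / 4) * expR (- (c i ^+ 2 / 4)) = 1 by rewrite expRxMexpNx_1.
transitivity (expR (c i ^+ 2 / 4) * expR (- (c i ^+ 2 / 4)) * (2 ^+ N.-1 * (P / D)));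
  last by rewrite e0 mul1r.
move: (expR _) (expR _) (D^-1) => E1 E2 D'; by field.
Qed.

Lemma hermiteI_sol_correct : (0 < N)%N -> is_multiple_hermiteI n c hermiteI_sol.
Proof.
move=> N0; split=> [i|j jN].
  by rewrite ffunE; apply: leq_trans (size_scale_leq _ _) (size_poly _ _).
under eq_bigr => i _ do rewrite moment_sol.
rewrite -mulr_sumr -/(residue_sum c N n (gauss_poly R j)).
rewrite residue_sumE //; [|exact: le_vsize|]; last first.
  by apply: (leq_trans (size_gauss_poly R j)).
case: eqP => [->|jN1].
  by rewrite coef_gauss_poly -exprMn mulrA mulr1 divff ?expr1n // pnatr_eq0.
rewrite nth_default ?mulr0 //; apply: (leq_trans (size_gauss_poly R j)).
by rewrite -ltnS prednK // ltn_neqAle jN andbT; apply/eqP => jE; apply: jN1; rewrite -jE.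
Qed.

(** This is sum_i D_i(d / dt) (f(t) exp(t ^ 2 / 4)) at t = c_i. With f = h_j it
    is the left-hand side of the j-th orthogonality condition for D, up to the
    factor sqrt(pi) (pairing_gauss_poly). *)
Definition pairing (D : 'I_p -> {poly R}) (f : {poly R}) : R :=
  \sum_i expR (c i ^+ 2 / 4) * \sum_(k < n i) (D i)`_k * k`!%:R *
    ((f \Po ('X + (c i)%:P)) * gauss_taylor (n i) (c i) 0)`_k.

Lemma pairingD D f g : pairing D (f + g) = pairing D f + pairing D g.
Proof.
rewrite /pairing -big_split /=; apply: eq_bigr => i _; rewrite -mulrDr -big_split /=.
congr (_ * _); apply: eq_bigr => k _.
by rewrite comp_polyD mulrDl coefD mulrDr.
Qed.

Lemma pairingZ D a f : pairing D (a *: f) = a * pairing D f.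
Proof.
rewrite /pairing mulr_sumr; apply: eq_bigr => i _; rewrite mulrCA; congr (_ * _).
rewrite mulr_sumr; apply: eq_bigr => k _.
by rewrite comp_polyZ -(scalerAl _ (f \Po _)) coefZ mulrCA.
Qed.

(** Since h_0 = 1, gauss_taylorE makes gauss_taylor M a 0 the inverse of the
    Hermite series. *)
Lemma gauss_taylor_shift M (a : R) j :
  eqmodX M ((gauss_poly R j \Po ('X + a%:P)) * gauss_taylor M a 0)
           (gauss_taylor M a j).
Proof.
apply: eqmodX_trans (eqmodX_mulr _ (eqmodX_sym (@gauss_taylorE R M a j))) _.
rewrite -mulrA [X in _ * X]mulrC.
have H := eqmodX_mull (gauss_taylor M a j) (@gauss_taylorE R M a 0).
by rewrite /= comp_polyC polyC1 mulr1 in H.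
Qed.

Lemma pairing_gauss_poly (D : 'I_p -> {poly R}) j : (forall i, (size (D i) <= n i)%N) ->
  Num.sqrt pi * pairing D (gauss_poly R j) =
  \sum_i \int[mu]_(x in [set: R]) (x ^+ j * (D i).[x] * expR (- x ^+ 2 + c i * x)).
Proof.
move=> Dn; rewrite /pairing mulr_sumr; apply: eq_bigr => i _.
rewrite (moment_poly _ _ (Dn i)) mulrA; congr (_ * _); apply: eq_bigr => k _.
rewrite gauss_taylor_shift // coef_series_poly // -mulrA; congr (_ * _).
by rewrite mulrC divfK // factS_neq0.
Qed.

(** The polynomials h_0, ..., h_(N - 1) have the degrees 0, ..., N - 1, hence
    span the polynomials of degree less than N. *)
Lemma pairing_eq0 (D : 'I_p -> {poly R}) :
  (forall j, (j < N)%N -> pairing D (gauss_poly R j) = 0) ->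
  forall f : {poly R}, (size f <= N)%N -> pairing D f = 0.
Proof.
move=> D0 f fN; have [d fd dN] : exists2 d, (size f <= d)%N & (d <= N)%N.
  by exists (size f).
elim: d f fd dN {fN} => [|d IH] f fd dN.
  have -> : f = 0 *: 0 by apply/eqP; rewrite scaler0 -size_poly_leq0.
  by rewrite pairingZ mul0r.
pose a := f`_d * 2 ^+ d.
have sg : (size (f - a *: gauss_poly R d)%R <= d)%N.
  apply/leq_sizeP => k; rewrite leq_eqVlt => /predU1P[<-|dk].
    rewrite coefB coefZ coef_gauss_poly /a -mulrA -exprMn.
    by rewrite mulrA mulr1 divff ?pnatr_eq0 // expr1n mulr1 subrr.
  rewrite coefB coefZ !nth_default ?mulr0 ?subrr //.
    exact: leq_trans (size_gauss_poly R d) dk.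
  exact: leq_trans fd dk.
have -> : f = (f - a *: gauss_poly R d) + a *: gauss_poly R d by rewrite subrK.
by rewrite pairingD pairingZ IH ?D0 ?mulr0 ?addr0 // ltnW.
Qed.

(** The test polynomial (t - c_i) ^ deg(D_i) * prod_(q != i) (t - c_q) ^ n_q
    isolates the leading coefficient of D_i. *)
Lemma pairing_inj (D : 'I_p -> {poly R}) : (forall i, (size (D i) <= n i)%N) ->
  (forall f : {poly R}, (size f <= N)%N -> pairing D f = 0) -> forall i, D i = 0.
Proof.
move=> Dn D0 i0; apply/eqP; apply/negPn/negP => Di0.
pose d := (size (D i0)).-1.
have dE : d.+1 = size (D i0) by rewrite /d prednK // size_poly_gt0.
have dn : (d < n i0)%N by rewrite dE.
pose Q : {poly R} := \prod_(q | q != i0) ('X - (c q)%:P) ^+ n q.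
pose f := ('X - (c i0)%:P) ^+ d * Q.
have sizeX (a : R) k : size (('X - a%:P) ^+ k) = k.+1 by rewrite size_exp_XsubC.
have sQ : size Q = (\sum_(q | q != i0) n q).+1.
  rewrite size_prod => [|q _]; last by rewrite -size_poly_gt0 sizeX.
  under eq_bigr do rewrite sizeX -addn1.
  by rewrite big_split /= sum1_card -addSn addnK.
have Q0 : Q != 0 by rewrite -size_poly_gt0 sQ.
have sf : (size f <= N)%N.
  rewrite size_monicM ?monic_exp ?monicXsubC // sizeX sQ addSn /= addnS -addSn.
  have -> : N = (n i0 + \sum_(q | q != i0) n q)%N by rewrite /N /vsize (bigD1 i0).
  by rewrite leq_add2r.
have compX (a b : R) : ('X - a%:P) \Po ('X + b%:P) = 'X + (b - a)%:P :> {poly R}.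
  by rewrite comp_polyB comp_polyX comp_polyC -addrA -polyCB.
have compf i : f \Po ('X + (c i)%:P) = ('X + (c i - c i0)%:P) ^+ d *
    \prod_(q | q != i0) ('X + (c i - c q)%:P) ^+ n q.
  rewrite /f /Q rmorphM rmorphXn rmorph_prod /= compX; congr (_ * _).
  by apply: eq_bigr => q _; rewrite rmorphXn /= compX.
have := D0 f sf; rewrite /pairing (bigD1 i0) //= [X in _ + X]big1 ?addr0; last first.
  move=> i ii0; rewrite big1 ?mulr0 // => k _.
  rewrite compf (bigD1 i) //= subrr polyC0 addr0 mulrCA -!mulrA coefXnM ltn_ord.
  by rewrite !mulr0.
have compf0 : f \Po ('X + (c i0)%:P) = 'X^d * \prod_(q | q != i0) ('X + (c i0 - c q)%:P) ^+ n q.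
  by rewrite compf subrr polyC0 addr0.
rewrite (bigD1 (Ordinal dn)) //= big1 ?addr0 compf0; last first.
  move=> k kd; have {}kd : nat_of_ord k != d.
    by apply: contra kd => /eqP kd; apply/eqP/val_inj.
  rewrite -[_ * _ * gauss_taylor _ _ _]mulrA coefXnM; case: ltnP => [_|dk]; first by rewrite mulr0.
  by rewrite nth_default ?mul0r // -dE ltn_neqAle eq_sym kd.
rewrite -[_ * _ * gauss_taylor _ _ _]mulrA coefXnM ltnn subnn -!horner_coef0 hornerM horner_prod.
rewrite horner_coef0 coef_series_poly; last by apply: leq_ltn_trans dn.
rewrite addn0 /= hornerC divr1 mulr1.
move/eqP; rewrite !mulf_eq0 expR_eq0 (negbTE (factS_neq0 R d)) /= orbF.
rewrite -[(D i0)`_d]/(lead_coef (D i0)) lead_coef_eq0 (negbTE Di0) /=.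
apply/negP; rewrite prodf_seq_neq0; apply/allP => q _; apply/implyP => qi0.
rewrite horner_exp hornerD hornerX hornerC add0r expf_neq0 //.
by rewrite subr_eq0 (inj_eq c_inj) eq_sym.
Qed.

Lemma is_multiple_hermiteI_unique H H' :
  is_multiple_hermiteI n c H -> is_multiple_hermiteI n c H' -> H' = H.
Proof.
move=> [sH mH] [sH' mH'].
have sp : Num.sqrt pi != 0 :> R by rewrite gt_eqF // sqrtr_gt0 pi_gt0.
have sD i : (size (H' i - H i)%R <= n i)%N.
  by apply: (leq_trans (size_polyD _ _)); rewrite geq_max size_polyN sH sH'.
suff D0 i : H' i - H i = 0 by apply/ffunP => i; apply/eqP; rewrite -subr_eq0 D0.
apply: (pairing_inj sD) => {i}; apply: pairing_eq0 => j jN.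
have pB : pairing (fun i => H' i - H i) (gauss_poly R j) =
    pairing H' (gauss_poly R j) - pairing H (gauss_poly R j).
  rewrite /pairing -sumrB; apply: eq_bigr => i _; rewrite -mulrBr -sumrB.
  by congr (_ * _); apply: eq_bigr => k _; rewrite coefB !mulrBl.
apply: (mulfI sp); rewrite pB mulrBr !pairing_gauss_poly // mH // mH' //.
by rewrite subrr mulr0.
Qed.

Lemma multiple_hermiteIE : (0 < N)%N -> multiple_hermiteI n c = hermiteI_sol.
Proof.
move=> N0; have sol := hermiteI_sol_correct N0.
apply: xget_unique; first by split => // H; exact: is_multiple_hermiteI_unique.
by move=> H [HH _]; exact: is_multiple_hermiteI_unique.
Qed.

End MultipleHermite.

(** * Explicit formula *)

Section Explicit.
Variables (R : realType) (p : nat) (c : 'I_p -> R) (n : 'I_p -> nat) (i : 'I_p).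
Variables (ni_ge1 : (1 <= n i)%N) (x : R).

(** The Taylor coefficients, at s = 0, of exp(x s) for q = i and of the factor
    (1 + s / (c_i - c_q)) ^- n_q otherwise. *)
Definition local_coef (q : 'I_p) : nat -> R :=
  if q == i then exp_coeff x else binom_coef (n q) (c q - c i).

(** The residue at t = c_i of exp((t - c_i) x - t ^ 2 / 4) / prod_q (t - c_q) ^ n_q,
    stripped of the constant exp(- c_i ^ 2 / 4) / prod_(q != i) (c_i - c_q) ^ n_q. *)
Definition local_residue : R := ((\prod_q series_poly (n i) (local_coef q)) *
  series_poly (n i) (hermite_coef (c i)))`_(n i).-1.

Lemma local_coefE : local_coef i = exp_coeff x.
Proof. by rewrite /local_coef eqxx. Qed.

Lemma hermiteI_sol_residue :
  (hermiteI_sol c n i).[x] = leading_factor c n i * local_residue.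
Proof.
rewrite hermiteI_solE // /local_residue /cofactor [in RHS](bigD1 i) //= local_coefE.
have -> : \prod_(q | q != i) series_poly (n i) (local_coef q) =
    \prod_(q | q != i) series_poly (n i) (binom_coef (n q) (c q - c i)).
  by apply: eq_bigr => q /negbTE qi; rewrite /local_coef qi.
by rewrite [series_poly _ (hermite_coef _) * _]mulrC mulrA.
Qed.

Lemma local_residue_sumE :
  \sum_(l : {ffun 'I_p -> 'I_(n i)} | (\sum_(q < p) l q <= (n i).-1)%N)
    (pochhammer (- (n i)%:R + 1) (\sum_(q < p) l q)%N / (l i)`!%:R
     * (\prod_(q < p | q != i)
          (pochhammer (n q)%:R (l q)
           / ((l q)`!%:R * (c q - c i) ^+ l q)))
     * (hermite R ((n i).-1 - \sum_(q < p) l q)%N).[c i / 2] * x ^+ l i)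
  = (-1) ^+ (n i).-1 * (n i).-1`!%:R * local_residue.
Proof.
rewrite /local_residue coef_prod_series mulr_sumr; apply: eq_bigr => l lm.
set m := (n i).-1 in lm *; set L := (\sum_(q < p) _)%N in lm *.
have -> : - (n i)%:R + 1 = - m%:R :> R.
  by rewrite -(prednK ni_ge1) -/m -natr1 opprD subrK.
rewrite pochhammer_oppn // coef_series_poly; last first.
  by rewrite -(prednK ni_ge1) ltnS leq_subr.
set P := \prod_(q < p | q != i) _.
have -> : \prod_q local_coef q (l q) = x ^+ l i / (l i)`!%:R * P.
  rewrite (bigD1 i) //= local_coefE; congr (_ * _).
  by apply: eq_bigr => q /negbTE qi; rewrite /local_coef qi.
rewrite /hermite_coef.
have -> : (-1) ^+ L = (-1) ^+ m * (-1) ^+ (m - L) :> R.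
  have sq : (-1) ^+ (m - L) * (-1) ^+ (m - L) = 1 :> R.
    by rewrite -exprD addnn -signr_odd odd_double.
  have -> : (-1) ^+ m = (-1) ^+ (m - L) * (-1) ^+ L :> R by rewrite -exprD subnK.
  by rewrite mulrAC sq mul1r.
have h1 := factS_neq0 R (l i); have h2 := factS_neq0 R (m - L).
by field; rewrite h1 h2.
Qed.

End Explicit.

(** * Stirling's formula *)

Section LogExpansion.
Variable R : realType.
Implicit Types (x y t : R).

(** The mean value theorem on [0, 1] for t |-> ln (1 + t y) - t y + (t y) ^ 2 / 2,
    whose derivative is t ^ 2 y ^ 3 / (1 + t y); parametrizing the segment from 0
    to y treats both signs of y at once. *)
Lemma ln1Dx_expansion y : `|y| <= 1 / 2 ->
  `|ln (1 + y) - y + y ^+ 2 / 2| <= 2 * `|y| ^+ 3.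
Proof.
move=> y2; have y12 : - (1 / 2) <= y <= 1 / 2 by rewrite -ler_norml.
pose h (t : R) := ln (1 + t * y) - t * y + (t * y) ^+ 2 / 2.
pose dh (t : R) := t ^+ 2 * y ^+ 3 / (1 + t * y).
have pos t : 0 <= t <= 1 -> 1 / 2 <= 1 + t * y by move=> t01; nra.
have h' t : 0 <= t <= 1 -> is_derive t 1 h (dh t).
  move=> t01; have tp := pos _ t01; have tp0 : 0 < 1 + t * y by lra.
  have d1 : is_derive t 1 (fun t : R => 1 + t * y) y.
    by apply: is_derive_eq; rewrite /GRing.scale /=; ring.
  have d2 : is_derive t 1 (@ln R \o (fun t : R => 1 + t * y)) ((1 + t * y)^-1 * y).
    by apply: is_derive1_comp; exact: is_derive1_ln.
  apply: is_derive_eq; rewrite /dh /GRing.scale /=.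
  by field; rewrite gt_eqF.
have [||t t01 ht] := @MVT_segment R h dh 0 1 ler01.
- by move=> t; rewrite in_itv /= => /andP[t0 t1]; apply: h'; rewrite !ltW.
- apply: derivable_within_continuous => t; rewrite in_itv /= => t01.
  by case: (h' t t01).
move: t01; rewrite in_itv /= => t01; have tp := pos _ t01.
have -> : ln (1 + y) - y + y ^+ 2 / 2 = h 1 - h 0.
  by rewrite /h !mul1r !mul0r addr0 ln1 expr0n /= mul0r !subr0 addr0 subr0.
rewrite ht subr0 mulr1 /dh normrM normfV normrM [`|y ^+ 3|]normrX.
have tp0 : 0 < 1 + t * y by lra.
rewrite (gtr0_norm tp0) ler_pdivrMr // ger0_norm ?sqr_ge0 //.
have t2 : t ^+ 2 <= 1 by nra.
have y3 : 0 <= `|y| ^+ 3 by rewrite exprn_ge0.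
by nra.
Qed.

(** The second-order term of the logarithm survives: b (w / sqrt b) ^ 2 = w ^ 2,
    while the cubic remainder is of order 1 / sqrt b. *)
Lemma cvg_ln_second_order (T : Type) (F : set_system T) (FF : Filter F)
    (b w : T -> R) (c : R) :
  b @ F --> +oo -> w @ F --> c ->
  (fun z => b z * ln (1 + w z / Num.sqrt (b z)) - Num.sqrt (b z) * w z) @ F
    --> - (c ^+ 2 / 2).
Proof.
move=> bF wF; have sF := cvg_sqrt_pinfty FF bF; have iF := cvg_inv_pinfty FF sF.
pose y z := w z / Num.sqrt (b z).
pose r z := b z * (ln (1 + y z) - y z + y z ^+ 2 / 2).
pose g z := 2 * `|w z| ^+ 3 * (Num.sqrt (b z))^-1.
have yF : y @ F --> (0 : R) by rewrite -(mulr0 c); exact: cvgM.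
have gF : g @ F --> (0 : R).
  rewrite -(mulr0 (2 * `|c| ^+ 3)); apply: cvgM => //.
  apply: cvgM; first exact: cvg_cst.
  by apply: (@cvg_exprn R _ F FF (fun z => `|w z|)); exact: cvg_norm.
have bpos : \forall z \near F, 0 < b z by move/cvgryPgt : bF; apply.
have rF : r @ F --> (0 : R).
  apply: (@squeeze_cvgr _ _ _ _ (fun z => - g z) g) => //; last first.
    by rewrite -oppr0; exact: cvgN.
  near=> z; rewrite -ler_norml.
  have bz : 0 < b z by near: z.
  have sz : 0 < Num.sqrt (b z) by rewrite sqrtr_gt0.
  have bE : b z = Num.sqrt (b z) ^+ 2 by rewrite sqr_sqrtr // ltW.
  rewrite /r /g normrM gtr0_norm //.
  have yz : `|y z| <= 1 / 2.
    by near: z; apply: (cvgr0_norm_le y yF); lra.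
  apply: (le_trans (ler_wpM2l (ltW bz) (ln1Dx_expansion yz))).
  rewrite /y normrM normfV (gtr0_norm sz) {1}bE.
  rewrite le_eqVlt; apply/orP; left; apply/eqP.
  by field; rewrite gt_eqF.
have -> : - (c ^+ 2 / 2) = - (c ^+ 2 / 2) + 0 by rewrite addr0.
have : (fun z => - (w z ^+ 2 / 2) + r z) @ F --> - (c ^+ 2 / 2) + 0.
  apply: cvgD => //; apply: cvgN; apply: cvgM; last exact: cvg_cst.
  exact: cvg_exprn.
apply: cvg_trans; apply: near_eq_cvg; near=> z.
have bz : 0 < b z by near: z.
have sz : 0 < Num.sqrt (b z) by rewrite sqrtr_gt0.
have bE : b z = Num.sqrt (b z) ^+ 2 by rewrite sqr_sqrtr // ltW.
rewrite /= /r /y; move: sz bE; move: (Num.sqrt (b z)) => u sz.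
move: (ln _) => L ->.
by field; rewrite gt_eqF.
Unshelve. all: by end_near. Qed.

End LogExpansion.

Section Stirling.
Variable R : realType.
Let mu := @lebesgue_measure R.
Implicit Types (x u t : R).

(** The integrand of Gamma(x + 1) after the substitution
    t = x + sqrt(x) u, divided by its maximum x ^ x * exp(-x). *)
Definition stirling_fun x u : R :=
  if - Num.sqrt x < u
  then expR (x * ln (1 + u / Num.sqrt x) - Num.sqrt x * u) else 0.

Lemma measurable_stirling_fun x : measurable_fun [set: R] (stirling_fun x).
Proof.
rewrite /stirling_fun; apply: measurable_fun_ifT => //.
  exact: measurable_fun_ltr.
apply: measurableT_comp => //; apply: measurable_funB; last first.
  exact: measurable_funM.
apply: measurable_funM => //; apply: measurableT_comp; first exact: measurable_ln.
by apply: measurable_funD => //; apply: measurable_funM.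
Qed.

(** With v = u / sqrt x and ln (1 + v) = 2 ln sqrt(1 + v) <= 2 (sqrt(1 + v) - 1),
    the exponent is at most - x (sqrt(1 + v) - 1) ^ 2
    = - (u / (1 + sqrt(1 + v))) ^ 2, which is at most 1 - |u| / 2.
    Finally exp(|u| / 2) >= 1 + u ^ 2 / 8. *)
Lemma stirling_fun_le x u : 1 <= x ->
  `|stirling_fun x u| <= 8 * expR 1 / oneDsqr u.
Proof.
move=> x1; have x0 : 0 < x by lra.
have one0 : 0 < oneDsqr u by rewrite (lt_le_trans ltr01).
rewrite /stirling_fun; case: ifPn => xu; last first.
  by rewrite normr0 divr_ge0 // ?mulr_ge0 ?expR_ge0 // ltW.
rewrite ger0_norm ?expR_ge0 //.
have sx1 : 1 <= Num.sqrt x by rewrite -[leLHS]sqrtr1 ler_wsqrtr.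
have sx0 : 0 < Num.sqrt x by lra.
have xE : x = Num.sqrt x ^+ 2 by rewrite sqr_sqrtr // ltW.
pose v := u / Num.sqrt x.
have uE : u = Num.sqrt x * v by rewrite /v mulrC divfK // gt_eqF.
have v1 : 0 < 1 + v by rewrite /v -ltrBlDl sub0r ltr_pdivlMr // mulN1r.
have rv0 : 0 < Num.sqrt (1 + v) by rewrite sqrtr_gt0.
have rvE : 1 + v = Num.sqrt (1 + v) ^+ 2 by rewrite sqr_sqrtr // ltW.
have lnv : ln (1 + v) <= 2 * (Num.sqrt (1 + v) - 1).
  have lns : ln (Num.sqrt (1 + v)) <= Num.sqrt (1 + v) - 1.
    have {1}-> : Num.sqrt (1 + v) = 1 + (Num.sqrt (1 + v) - 1) by ring.
    by apply: le_ln1Dx; lra.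
  by rewrite {1}rvE lnXn // mulr2n; lra.
have expo : x * ln (1 + v) - Num.sqrt x * u <= 1 - `|u| / 2.
  apply: (@le_trans _ _ (- (Num.sqrt x * (Num.sqrt (1 + v) - 1)) ^+ 2)).
    have -> : Num.sqrt x * u = x * v by rewrite uE [in RHS]xE; ring.
    rewrite exprMn -xE.
    have : x * ln (1 + v) <= x * (2 * (Num.sqrt (1 + v) - 1)).
      by rewrite ler_wpM2l // ltW.
    have : x * v = x * (Num.sqrt (1 + v) ^+ 2 - 1) by rewrite -rvE; ring.
    by move: (Num.sqrt (1 + v)) (ln (1 + v)) => r L Hv HL; lra.
  set a := Num.sqrt x * _.
  have uE2 : u = a * (2 + a / Num.sqrt x).
    rewrite uE /a; move: rvE; move: (Num.sqrt (1 + v)) => r rE.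
    have -> : v = r ^+ 2 - 1 by rewrite -rE; ring.
    by field; rewrite gt_eqF.
  have u_le : `|u| <= `|a| * (2 + `|a|).
    rewrite uE2 normrM ler_wpM2l // (le_trans (ler_normD _ _)) //.
    rewrite ger0_norm // lerD2l normrM normfV (gtr0_norm sx0).
    by rewrite ler_pdivrMr // ler_peMr.
  have := sqr_ge0 (`|a| - 1); rewrite sqrrB1 => aa.
  rewrite -[a ^+ 2]real_normK ?num_real //.
  by nra.
apply: (@le_trans _ _ (expR (1 - `|u| / 2))); first by rewrite ler_expR.
have D8 : oneDsqr u <= 8 * expR (`|u| / 2).
  have u2 : 0 <= `|u| / 2 by rewrite divr_ge0.
  have := expR_ge1Dxn 1 u2; have -> : 2`!%:R = 2 :> R by [].
  rewrite expr_div_n real_normK ?num_real // /oneDsqr.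
  by have := sqr_ge0 u; lra.
rewrite expRD expRN ler_pdivlMr // mulrAC ler_pdivrMr ?expR_gt0 //.
by rewrite -mulrA mulrCA ler_wpM2l ?expR_ge0.
Qed.

Lemma cvg_stirling_fun (x : nat -> R) u : x n @[n --> \oo] --> +oo ->
  stirling_fun (x n) u @[n --> \oo] --> expR (- (u ^+ 2 / 2)).
Proof.
move=> xoo.
have spos : \forall n \near \oo, - u < Num.sqrt (x n).
  have soo : Num.sqrt (x n) @[n --> \oo] --> +oo by exact: cvg_sqrt_pinfty.
  by move/cvgryPgt: soo; apply.
have : expR (x n * ln (1 + u / Num.sqrt (x n)) - Num.sqrt (x n) * u) @[n --> \oo]
    --> expR (- (u ^+ 2 / 2)).
  apply: (cvg_comp _ expR); last exact: continuous_expR.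
  by apply: (@cvg_ln_second_order R nat \oo _ x (fun=> u)) => //; exact: cvg_cst.
apply: cvg_trans; apply: near_eq_cvg; near=> n; rewrite /stirling_fun /= ifT //.
by rewrite ltrNl; near: n.
Unshelve. all: by end_near. Qed.

Lemma integral_gauss_half : \int[mu]_u expR (- (u ^+ 2 / 2)) = Num.sqrt (2 * pi) :> R.
Proof.
have := @Rintegral_normal_fun R 0 1 (oner_neq0 _).
rewrite /normal_peak invrK expr1n mul1r mulr_natl => <-.
by apply: eq_Rintegral => u _; rewrite /normal_fun subr0 expr1n mulNr.
Qed.

(** The substitution t = x + sqrt(x) u, which maps u > - sqrt(x) to t > 0. *)
Lemma Gamma_stirling x : 1 <= x ->
  Gamma (x + 1) = x `^ x * expR (- x) * Num.sqrt x * \int[mu]_u stirling_fun x u.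
Proof.
move=> x1; have x0 : 0 < x by lra.
have sx0 : 0 < Num.sqrt x by rewrite sqrtr_gt0.
have xE : Num.sqrt x ^+ 2 = x by rewrite sqr_sqrtr // ltW.
rewrite /Gamma.
have -> : Num.truncn (1 - (x + 1)) = 0%N.
  by apply/truncn0Pn; rewrite -ltNge; lra.
rewrite /pochhammer big_ord0 divr1 addr0 addrK.
rewrite -RintegralZl //; last first.
  apply: integrable_dominated (measurable_stirling_fun x) _ => u.
  exact: stirling_fun_le.
pose F (u : R) : R := Num.sqrt x * u + x.
pose G (t : R) : R := t `^ x * expR (- t).
have Fa : F (- Num.sqrt x) = 0 by rewrite /F mulrN -expr2 xE addNr.
have dF u : is_derive u 1 F (Num.sqrt x).
  by apply: is_derive_eq; rewrite /GRing.scale /=; ring.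
have cF : continuous F.
  by move=> u; apply/differentiable_continuous/derivable1_diffP; case: (dF u).
have F'E : derive1 F = cst (Num.sqrt x).
  by apply/funext => u; rewrite derive1E; have [_ ->] := dF u.
have mG : measurable_fun [set: R] G.
  apply: measurable_funM; first exact: measurable_powR.
  by apply: measurableT_comp => //; exact: measurable_funN.
have Foo : F u @[u --> +oo] --> +oo.
  apply/cvgryPge => A; exists ((A - x) / Num.sqrt x); split; first exact: num_real.
  by move=> u /ltW; rewrite /F ler_pdivrMr // lerBlDr mulrC.
congr fine.
rewrite integral_itv_obnd_cbnd; last exact/measurable_EFinP/measurable_funTS.
rewrite -{1}Fa (@increasing_ge0_integration_by_substitutiony _ F G); first last.
- by move=> t _; rewrite mulr_ge0 ?powR_ge0 ?expR_ge0.
- rewrite Fa; apply/continuous_within_itvcyP; split.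
    move=> t; rewrite in_itv /= andbT => t0.
    have ct : {for t, continuous (fun t : R => t `^ x)}.
      apply/differentiable_continuous/derivable1_diffP.
      by apply: derivable_powR; rewrite in_itv /= t0.
    apply: cvgM; first exact: ct.
    by apply: (cvg_comp _ expR (@cvgN _ _ _ _ _ _ _ cvg_id)); exact: continuous_expR.
  have cN : expR (- t) @[t --> 0^'+] --> expR (- 0 : R).
    apply: cvg_at_right_filter; apply: (cvg_comp (-%R) expR).
      by apply: cvgN; exact: cvg_id.
    exact: continuous_expR.
  have GE : G 0 = 0 * expR (- 0) by rewrite /G powR0 ?gt_eqF.
  by rewrite GE; apply: cvgM => //; exact: powR_cvg0.
- exact: Foo.
- split=> [u _|]; first by case: (dF u).
  by apply: cvg_at_right_filter; exact: cF.
- by rewrite F'E; exact: is_cvg_cst.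
- by rewrite F'E; exact: is_cvg_cst.
- by move=> u _; rewrite F'E; exact: cst_continuous.
- by move=> u v _ _ uv; rewrite /F ltrD2r ltr_pM2l.
rewrite F'E -integral_itv_obnd_cbnd; last first.
  apply/measurable_EFinP/measurable_funTS.
  apply: measurable_funM => //; apply: measurableT_comp => //.
  exact: continuous_measurable_fun.
rewrite [LHS]integral_mkcond; apply: eq_integral => u _.
rewrite patchE; case: ifPn; rewrite ?inE ?notin_setE /= in_itv /= andbT => au.
  rewrite /stirling_fun au; congr EFin.
  rewrite mulrfctE /= /G /F /=.
  have v1 : 0 < 1 + u / Num.sqrt x.
    by rewrite -ltrBlDl sub0r ltr_pdivlMr // mulN1r.
  have E : Num.sqrt x * u + x = x * (1 + u / Num.sqrt x).
    move: xE sx0; move: (Num.sqrt x) => r <- r0.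
    by field; rewrite gt_eqF.
  rewrite {1}E powRM ?ltW //.
  have -> : (1 + u / Num.sqrt x) `^ x = expR (x * ln (1 + u / Num.sqrt x)).
    by rewrite /powR gt_eqF.
  by rewrite opprD !expRD; ring.
by move/negP/negbTE: au => au; rewrite /stirling_fun au mulr0.
Qed.


(** Laplace's method: the integrand of Gamma_stirling converges to
    exp(- u ^ 2 / 2) and is dominated by stirling_fun_le. *)
Lemma Gamma_asymp :
  Gamma (x + 1) / (x `^ x * expR (- x) * Num.sqrt x) @[x --> +oo]
    --> (Num.sqrt (2 * pi) : R).
Proof.
apply/cvg_pinftyP => x xoo; rewrite -integral_gauss_half.
have : \int[mu]_u stirling_fun (x n) u @[n --> \oo]
   --> \int[mu]_u expR (- (u ^+ 2 / 2)).
  apply: (@Rintegral_dominated_cvg _ _ _ (8 * expR 1)).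
  - by move=> n; exact: measurable_stirling_fun.
  - apply: continuous_measurable_fun => u; apply: continuous_comp; last exact: continuous_expR.
    apply: cvgN; apply: cvgM; last exact: cvg_cst.
    exact: exprn_continuous.
  - near=> n => u; apply: stirling_fun_le.
    by near: n; move/cvgryPge: xoo; apply.
  - by move=> u; exact: cvg_stirling_fun.
apply: cvg_trans; apply: near_eq_cvg; near=> n.
have x1 : 1 <= x n by near: n; move/cvgryPge: xoo; apply.
rewrite Gamma_stirling // mulrAC divff ?mul1r //.
by rewrite !mulf_neq0 ?gt_eqF ?expR_gt0 ?powR_gt0 ?sqrtr_gt0 //; lra.
Unshelve. all: by end_near. Qed.

End Stirling.

Section GammaAsymptotics.
Variable R : realType.

(** Stirling's formula at b + w sqrt(b), with main terms expressed in b: the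
    second-order terms of b ln(1 + w / sqrt b) and w sqrt(b) ln(1 + w / sqrt b)
    contribute - c ^ 2 / 2 and c ^ 2. *)
Lemma cvg_Gamma_shift (T : Type) (F : set_system T) (FF : Filter F)
    (b w : T -> R) (c : R) :
  b @ F --> +oo -> w @ F --> c ->
  (fun z => Gamma (b z + w z * Num.sqrt (b z) + 1) /
     (b z `^ (b z + w z * Num.sqrt (b z)) * expR (- b z) * Num.sqrt (b z))) @ F
  --> Num.sqrt (2 * pi) * expR (c ^+ 2 / 2).
Proof.
move=> bF wF; have sF := cvg_sqrt_pinfty FF bF; have iF := cvg_inv_pinfty FF sF.
have lF := cvg_ln_second_order FF bF wF.
pose y z := w z / Num.sqrt (b z).
pose x z := b z + w z * Num.sqrt (b z).
have yF : y @ F --> (0 : R) by rewrite -(mulr0 c); exact: cvgM.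
have bpos : \forall z \near F, 0 < b z by move/cvgryPgt : bF; apply.
have ysmall : \forall z \near F, `|y z| <= 1 / 2.
  by apply: (cvgr0_norm_le y yF); lra.
have xE z : 0 < b z -> x z = b z * (1 + y z).
  move=> bz; have sz : 0 < Num.sqrt (b z) by rewrite sqrtr_gt0.
  have bE : b z = Num.sqrt (b z) ^+ 2 by rewrite sqr_sqrtr // ltW.
  rewrite /x /y; move: sz bE; move: (Num.sqrt (b z)) => r r0 ->.
  by field; rewrite gt_eqF.
have xF : x @ F --> +oo.
  apply/cvgryPge => A; near=> z.
  have bz : 0 < b z by near: z.
  have yz : `|y z| <= 1 / 2 by near: z.
  have bA : 2 * A <= b z by near: z; move/cvgryPge : bF; apply.
  by rewrite xE //; move: yz; rewrite ler_norml => /andP[y1 y2]; nra.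
have GF : (fun z => Gamma (x z + 1) / (x z `^ x z * expR (- x z) * Num.sqrt (x z))) @ F
    --> Num.sqrt (2 * pi).
  exact: (cvg_comp x _ xF (@Gamma_asymp R)).
have EF : (fun z => expR (b z * ln (1 + y z) - Num.sqrt (b z) * w z
     + w z * (w z + (Num.sqrt (b z))^-1 *
         (b z * ln (1 + y z) - Num.sqrt (b z) * w z)))) @ F --> expR (c ^+ 2 / 2).
  apply: (cvg_comp _ expR); last exact: continuous_expR.
  have -> : c ^+ 2 / 2 = - (c ^+ 2 / 2) + c * (c + 0 * - (c ^+ 2 / 2)) by lra.
  apply: cvgD => //; apply: cvgM => //; apply: cvgD => //; exact: cvgM.
have oneF : (fun z => 1 + y z) @ F --> (1 : R).
  rewrite -[X in _ --> X]addr0.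
  by apply: cvgD => //; exact: cvg_cst.
have SF : (fun z => Num.sqrt (1 + y z)) @ F --> (1 : R).
  rewrite -[X in _ --> X](@sqrtr1 R).
  by apply: continuous_cvg => //; exact: sqrt_continuous.
have : (fun z => Gamma (x z + 1) / (x z `^ x z * expR (- x z) * Num.sqrt (x z))
    * expR (b z * ln (1 + y z) - Num.sqrt (b z) * w z
     + w z * (w z + (Num.sqrt (b z))^-1 *
         (b z * ln (1 + y z) - Num.sqrt (b z) * w z))) * Num.sqrt (1 + y z)) @ F
    --> Num.sqrt (2 * pi) * expR (c ^+ 2 / 2) * 1.
  by apply: cvgM => //; apply: cvgM.
rewrite mulr1; apply: cvg_trans; apply: near_eq_cvg; near=> z.
have bz : 0 < b z by near: z.
have sz : 0 < Num.sqrt (b z) by rewrite sqrtr_gt0.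
have yz : `|y z| <= 1 / 2 by near: z.
have yz1 : 0 < 1 + y z by move: yz; rewrite ler_norml => /andP[y1 y2]; lra.
have xz : 0 < x z by rewrite xE // mulr_gt0.
have powE : x z `^ x z = b z `^ x z * expR (x z * ln (1 + y z)).
  have <- : (1 + y z) `^ x z = expR (x z * ln (1 + y z)) by rewrite /powR gt_eqF.
  by rewrite {1}xE // powRM // ltW.
have sqE : Num.sqrt (x z) = Num.sqrt (b z) * Num.sqrt (1 + y z).
  by rewrite xE // sqrtrM // ltW.
have expE : expR (b z * ln (1 + y z) - Num.sqrt (b z) * w z
     + w z * (w z + (Num.sqrt (b z))^-1 * (b z * ln (1 + y z) - Num.sqrt (b z) * w z)))
   = expR (x z * ln (1 + y z)) * expR (- x z) / expR (- b z).
  rewrite -expRD -expRB; congr expR.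
  have bE : b z = Num.sqrt (b z) ^+ 2 by rewrite sqr_sqrtr // ltW.
  rewrite /x; move: sz bE (ln _); move: (Num.sqrt (b z)) => r r0 -> L.
  by field; rewrite gt_eqF.
rewrite expE powE sqE.
have h1 := expR_gt0 (x z * ln (1 + y z)); have h2 := expR_gt0 (- x z).
have h3 := expR_gt0 (- b z); have h4 := powR_gt0 (x z) bz.
have h5 : 0 < Num.sqrt (1 + y z) by rewrite sqrtr_gt0.
by field; rewrite !gt_eqF.
Unshelve. all: by end_near. Qed.

End GammaAsymptotics.

(** * Rescaled finite differences *)

Section FiniteDifferences.
Variable R : realType.
Implicit Types (f g : nat -> R) (k l m : nat).

Definition fdiff f : nat -> R := fun l => f l.+1 - f l.

Lemma fdiff_shift f k l :
  iter k fdiff f l.+1 = iter k fdiff f l + iter k.+1 fdiff f l.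
Proof. by rewrite iterS /fdiff addrC subrK. Qed.

Lemma eq_fdiff f g k l : f =1 g -> iter k fdiff f l = iter k fdiff g l.
Proof. by move=> /funext ->. Qed.

Lemma fdiffD f g k l : iter k fdiff (fun l => f l + g l) l =
  iter k fdiff f l + iter k fdiff g l.
Proof.
by elim: k l => [//|k IH] l; rewrite !iterS /fdiff !IH; ring.
Qed.

Lemma fdiffZ (a : R) f k l : iter k fdiff (fun l => a * f l) l = a * iter k fdiff f l.
Proof.
by elim: k l => [//|k IH] l; rewrite !iterS /fdiff !IH; ring.
Qed.

(** The k-th difference of a first-order recurrence whose coefficients are
    linear in l; by Leibniz' rule only one further difference enters. *)
Lemma fdiff_recurrence f (kap A C del : R) k l :
  (forall j, (j <= k)%N ->
     kap * (A + (l + j)%:R) * fdiff f (l + j) = (C - del * (l + j)%:R) * f (l + j)%N) ->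
  kap * (A + (l + k)%:R) * iter k.+1 fdiff f l + kap * k%:R * iter k fdiff f l =
  (C - del * (l + k)%:R) * iter k fdiff f l - del * k%:R * iter k.-1 fdiff f l.
Proof.
elim: k l => [|k IH] l H.
  by have := H 0%N isT; rewrite addn0 /= => ->; ring.
have H1 := IH l (fun j jk => H j (leqW jk)).
have H2 : kap * (A + (l.+1 + k)%:R) * iter k.+1 fdiff f l.+1 + kap * k%:R * iter k fdiff f l.+1 =
  (C - del * (l.+1 + k)%:R) * iter k fdiff f l.+1 - del * k%:R * iter k.-1 fdiff f l.+1.
  by apply: IH => j jk; have := H j.+1 jk; rewrite addnS addSn.
have kE : del * k%:R * iter k.-1.+1 fdiff f l = del * k%:R * iter k fdiff f l.
  by case: (k) => [|k'] //=; rewrite mulr0 !mul0r.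
move: H1 H2 kE; rewrite !fdiff_shift addSn addnS -!natr1 natrD [k.+1.-1]/=.
move: (iter k.+2 _ _ _) (iter k.+1 _ _ _) (iter k.-1.+1 _ _ _) (iter k _ _ _)
  (iter k.-1 _ _ _) => D2 D1 D0' D0 D' H1 H2 kE.
by lra.
Qed.

(** Since (-m)_l / l! = (-1) ^ l binom(m, l), a hypergeometric sum with the
    numerator parameter -m is an m-th difference. *)
Lemma sum_pochhammer_fdiff m f :
  \sum_(l < m.+1) pochhammer (- m%:R : R) l / l`!%:R * f l =
  (-1) ^+ m * iter m fdiff f 0%N.
Proof.
have -> : \sum_(l < m.+1) pochhammer (- m%:R : R) l / l`!%:R * f l =
    \sum_(l < m.+1) (-1) ^+ l * 'C(m, l)%:R * f l.
  apply: eq_bigr => -[l /=]; rewrite ltnS => lm _; congr (_ * _).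
  rewrite pochhammer_oppn //.
  have h1 := factS_neq0 R l; have h2 := factS_neq0 R (m - l).
  by rewrite -(bin_fact lm) !natrM; field; rewrite h1 h2.
elim: m f => [|m IH] f; first by rewrite big_ord1 /= bin0; ring.
rewrite iterSr exprS -mulrA -IH big_ord_recl /= bin0.
under eq_bigr => l _.
  rewrite /bump /= add1n binS natrD exprS.
  rewrite (_ : _ * _ = - ((-1) ^+ l * 'C(m, l)%:R * f l.+1) +
     (-1) ^+ l.+1 * 'C(m, l.+1)%:R * f l.+1); last by rewrite exprS; ring.
  over.
rewrite big_split /= addrCA [X in _ + X](_ : _ =
    \sum_(l < m.+1) (-1) ^+ l * 'C(m, l)%:R * f l).
  rewrite -big_split /= mulN1r -sumrN; apply: eq_bigr => l _; rewrite /fdiff; ring.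
rewrite [RHS]big_ord_recl /= bin0; congr (_ + _).
rewrite big_ord_recr /= bin_small // mulr0 mul0r addr0.
by apply: eq_bigr => l _; rewrite /bump.
Qed.

End FiniteDifferences.

Arguments fdiff {R} f l.

Section Convolution.
Variable R : realType.
Implicit Types (a b : nat -> R) (k M : nat).

Definition conv a b k : R := \sum_(j < k.+1) a j * b (k - j)%N.

(** Coefficients of the derivative of a power series. *)
Definition dseq a : nat -> R := fun k => k.+1%:R * a k.+1.

Lemma coef_mul_series M a b k : (k < M)%N ->
  (series_poly M a * series_poly M b)`_k = conv a b k.
Proof.
move=> kM; rewrite coefM; apply: eq_bigr => -[j /=]; rewrite ltnS => jk _.
rewrite !coef_series_poly //; first exact: leq_ltn_trans (leq_subr _ _) kM.
exact: leq_ltn_trans jk kM.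
Qed.

Lemma deriv_series M a :
  eqmodX M (series_poly M.+1 a)^`() (series_poly M.+1 (dseq a)).
Proof.
move=> k kM; rewrite coef_deriv !coef_series_poly //; last exact: ltnW.
by rewrite /dseq mulr_natl.
Qed.

Lemma conv_dseq a b k :
  k.+1%:R * conv a b k.+1 = conv (dseq a) b k + conv a (dseq b) k.
Proof.
rewrite -(@coef_mul_series k.+2) // mulr_natl -coef_deriv derivM coefD.
rewrite (eqmodX_mulr _ (@deriv_series k.+1 a)) //.
rewrite (eqmodX_mull _ (@deriv_series k.+1 b)) //.
by rewrite !coef_mul_series // ltnW.
Qed.

End Convolution.

Section DifferenceLimits.
Variables (R : realType) (T : Type) (F : set_system T) (FF : Filter F).
Variables (s : T -> R) (sF : s @ F --> +oo).
Implicit Types (f g : T -> nat -> R) (phi psi : nat -> R) (k l m M : nat).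

(** f_z(l) behaves like the values at t = l / s_z of a function with Taylor
    coefficients phi at t = 0: difference quotients with the step 1 / s_z take
    the place of derivatives. *)
Definition taylor_cvg f phi := forall k,
  (fun z => s z ^+ k * iter k fdiff (f z) 0%N / k`!%:R) @ F --> phi k.

Lemma invs_cvg0 : (fun z => (s z)^-1) @ F --> (0 : R).
Proof. exact: cvg_inv_pinfty. Qed.

Lemma s_gt0 : \forall z \near F, 0 < s z.
Proof. by move/cvgryPgt : sF; apply. Qed.

Lemma near_forall_leq (P : T -> nat -> Prop) m :
  (forall l, \forall z \near F, P z l) ->
  \forall z \near F, forall l, (l <= m)%N -> P z l.
Proof.
move=> PF; elim: m => [|m IH]; first by apply: filterS (PF 0%N) => z Pz [].
apply: filterS2 IH (PF m.+1) => z H1 H2 l.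
by rewrite leq_eqVlt => /predU1P[->//|]; rewrite ltnS; exact: H1.
Qed.

(** The base point 0 of the differences can be replaced with any fixed l, as
    consecutive k-th differences differ by a (k + 1)-st, which is smaller by a
    factor s. *)
Lemma taylor_cvg_at f phi k l : taylor_cvg f phi ->
  (fun z => s z ^+ k * iter k fdiff (f z) l / k`!%:R) @ F --> phi k.
Proof.
move=> fphi; elim: l k => [|l IH] k; first exact: fphi.
have : (fun z => s z ^+ k * iter k fdiff (f z) l / k`!%:R +
    k.+1%:R * (s z)^-1 * (s z ^+ k.+1 * iter k.+1 fdiff (f z) l / k.+1`!%:R)) @ F
   --> phi k + k.+1%:R * 0 * phi k.+1.
  apply: cvgD => //; apply: cvgM => //; apply: cvgM; first exact: cvg_cst.
  exact: invs_cvg0.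
rewrite mulr0 mul0r addr0; apply: cvg_trans; apply: near_eq_cvg; near=> z.
have s0 : s z != 0 by rewrite gt_eqF //; near: z; exact: s_gt0.
rewrite fdiff_shift factS natrM exprS.
have h1 := factS_neq0 R k; have h2 : 1 + k%:R != 0 :> R by rewrite addrC natr1 pnatr_eq0.
by field; rewrite h1 h2 s0.
Unshelve. all: by end_near. Qed.

Lemma taylor_cvg_shift f phi : taylor_cvg f phi ->
  taylor_cvg (fun z l => f z l.+1) phi.
Proof.
move=> fphi k; have := @taylor_cvg_at f phi k 1 fphi.
rewrite (_ : (fun z => _) = (fun z =>
  s z ^+ k * iter k fdiff (fun l : nat => f z l.+1) 0%N / k`!%:R)) //.
apply/funext => z; congr (_ * _ / _).
by elim: k 0%N => [//|k IH] l; rewrite !iterS /fdiff !IH.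
Qed.

Lemma taylor_cvg_diff f phi : taylor_cvg f phi ->
  taylor_cvg (fun z l => s z * fdiff (f z) l) (dseq phi).
Proof.
move=> fphi k; have : (fun z => k.+1%:R *
    (s z ^+ k.+1 * iter k.+1 fdiff (f z) 0%N / k.+1`!%:R)) @ F --> k.+1%:R * phi k.+1.
  by apply: cvgM; [exact: cvg_cst|exact: fphi].
apply: cvg_trans; apply: near_eq_cvg; near=> z.
rewrite fdiffZ -iterSr factS natrM exprS.
have h1 := factS_neq0 R k; have h2 : 1 + k%:R != 0 :> R by rewrite addrC natr1 pnatr_eq0.
by field; rewrite h1 h2.
Unshelve. all: by end_near. Qed.

(** As for Taylor series, products correspond to Cauchy products: s times the
    difference satisfies the product rule, with one factor shifted. *)
Lemma taylor_cvgM f g phi psi : taylor_cvg f phi -> taylor_cvg g psi ->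
  taylor_cvg (fun z l => f z l * g z l) (conv phi psi).
Proof.
move=> + + k; elim: k f g phi psi => [|k IH] f g phi psi fphi gpsi.
  have : (fun z => (s z ^+ 0 * iter 0 fdiff (f z) 0%N / 0`!%:R) *
       (s z ^+ 0 * iter 0 fdiff (g z) 0%N / 0`!%:R)) @ F --> phi 0%N * psi 0%N.
    by apply: cvgM; [exact: fphi|exact: gpsi].
  rewrite /conv big_ord1 subn0.
  apply: cvg_trans; apply: near_eq_cvg; near=> z.
  by rewrite /= !mul1r !divr1.
have H1 := IH _ _ _ _ (taylor_cvg_diff fphi) (taylor_cvg_shift gpsi).
have H2 := IH _ _ _ _ fphi (taylor_cvg_diff gpsi).
have k0 : k.+1%:R != 0 :> R by rewrite pnatr_eq0.
have -> : conv phi psi k.+1 = k.+1%:R^-1 * (conv (dseq phi) psi k + conv phi (dseq psi) k).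
  by rewrite -conv_dseq mulKf.
have : (fun z => k.+1%:R^-1 *
   (s z ^+ k * iter k fdiff (fun l => s z * fdiff (f z) l * g z l.+1) 0%N / k`!%:R
  + s z ^+ k * iter k fdiff (fun l => f z l * (s z * fdiff (g z) l)) 0%N / k`!%:R)) @ F
   --> k.+1%:R^-1 * (conv (dseq phi) psi k + conv phi (dseq psi) k).
  by apply: cvgM; [exact: cvg_cst|exact: cvgD].
apply: cvg_trans; apply: near_eq_cvg; near=> z.
rewrite iterSr.
rewrite [in RHS](eq_fdiff (g := fun l => fdiff (f z) l * g z l.+1 + f z l * fdiff (g z) l)).
  rewrite fdiffD.
  rewrite (eq_fdiff (f := fun l => s z * fdiff (f z) l * g z l.+1)
    (g := fun l => s z * (fdiff (f z) l * g z l.+1))) => [|l]; last by ring.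
  rewrite (eq_fdiff (f := fun l => f z l * (s z * fdiff (g z) l))
    (g := fun l => s z * (f z l * fdiff (g z) l))) => [|l]; last by ring.
  rewrite !fdiffZ factS natrM exprS.
  have h1 := factS_neq0 R k; have h2 : 1 + k%:R != 0 :> R by rewrite addrC natr1 pnatr_eq0.
  by field; rewrite h1 h2.
by move=> l; rewrite /fdiff; ring.
Unshelve. all: by end_near. Qed.

Lemma taylor_cvg_prod (I : finType) (P : pred I)
    (f : I -> T -> nat -> R) (phi : I -> nat -> R) :
  (forall i, P i -> taylor_cvg (f i) (phi i)) ->
  taylor_cvg (fun z l => \prod_(i | P i) f i z l)
    (fun k => (\prod_(i | P i) series_poly k.+1 (phi i))`_k).
Proof.
move=> fphi.
elim: (index_enum I) => [|i r IH] k.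
  have -> : (\prod_(i <- [::] | P i) series_poly k.+1 (phi i))`_k =
    (if k is 0 then 1 else 0).
    by rewrite big_nil coef1; case: (k).
  apply: cvg_near_cst; apply: nearW => z.
  rewrite (eq_fdiff (g := fun=> 1)) => [|l]; last by rewrite big_nil.
  case: k => [|k]; first by rewrite expr0 mul1r fact0 divr1.
  suff -> : iter k.+1 fdiff (fun=> 1 : R) 0%N = 0 by rewrite mulr0 mul0r.
  by elim: k 0%N => [|k IH] l; rewrite iterS /fdiff ?subrr // !IH subrr.
rewrite big_cons; case: (boolP (P i)) => Pi; last first.
  have := IH k; apply: cvg_trans; apply: near_eq_cvg; apply: nearW => z.
  by congr (_ * _ / _); apply: eq_fdiff => l; rewrite big_cons (negbTE Pi).
have -> : (series_poly k.+1 (phi i) * \prod_(j <- r | P j) series_poly k.+1 (phi j))`_k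
  = conv (phi i) (fun k => (\prod_(j <- r | P j) series_poly k.+1 (phi j))`_k) k.
  rewrite coefM; apply: eq_bigr => -[j /=]; rewrite ltnS => jk _.
  rewrite coef_series_poly //; congr (_ * _).
  apply/esym; apply: (@eqmodX_prod _ _ _ _ (k - j).+1) => // q _.
  by apply: eqmodX_series; rewrite ltnS leq_subr.
have H : taylor_cvg _ _ := taylor_cvgM (fphi i Pi) IH.
move: (H k).
apply: cvg_trans; apply: near_eq_cvg; apply: nearW => z.
by congr (_ * _ / _); apply: eq_fdiff => l; rewrite big_cons Pi.
Qed.

Lemma eq_taylor_cvg f g phi : (forall l, \forall z \near F, f z l = g z l) ->
  taylor_cvg f phi -> taylor_cvg g phi.
Proof.
move=> fg fphi k; have := fphi k; apply: cvg_trans; apply: near_eq_cvg.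
apply: filterS (near_forall_leq k fg) => z fgz; congr (_ * _ / _).
suff E j l : (l + j <= k)%N -> iter j fdiff (f z) l = iter j fdiff (g z) l.
  exact: E.
elim: j l => [|j IH] l; first by rewrite addn0; exact: fgz.
rewrite addnS => lj; rewrite !iterS /fdiff !IH //; exact: ltnW.
Qed.

(** l |-> (1 + x / s) ^ l samples exp(x t). *)
Lemma taylor_cvg_exp (x : R) :
  taylor_cvg (fun z l => (1 + x / s z) ^+ l) (exp_coeff x).
Proof.
move=> k; apply: cvg_near_cst; near=> z.
have s0 : s z != 0 by rewrite gt_eqF //; near: z; exact: s_gt0.
have -> : iter k fdiff (fun l => (1 + x / s z) ^+ l) 0%N = (x / s z) ^+ k.
  suff E l : iter k fdiff (fun l => (1 + x / s z) ^+ l) l =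
      (x / s z) ^+ k * (1 + x / s z) ^+ l by rewrite E mulr1.
  elim: k l => [|k IH] l; first by rewrite mul1r.
  by rewrite iterS /fdiff !IH !exprS; ring.
by rewrite -exprMn (mulrC (s z)) divfK.
Unshelve. all: by end_near. Qed.

(** With t = l / s, the relation (a + 1 + l) (v(l + 1) - v(l)) = - n v(l)
    discretizes (g + t) v'(t) = - n v(t), with the solution (1 + t / g) ^- n. *)
Lemma taylor_cvg_binom n (a : T -> R) (g : R) (v : T -> nat -> R) : g != 0 ->
  (fun z => a z / s z) @ F --> g -> (\forall z \near F, v z 0%N = 1) ->
  (forall l, \forall z \near F,
     (a z + 1 + l%:R) * (v z l.+1 - v z l) = - n%:R * v z l) ->
  taylor_cvg v (binom_coef n (- g)).
Proof.
move=> g0 ag v0 vrec; elim=> [|k IH].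
  rewrite binom_coef0; apply: cvg_near_cst; apply: filterS v0 => z vz.
  by rewrite /= vz mulr1 fact0 divr1.
have lim : (fun z => (a z + 1 + k%:R) / s z) @ F --> g.
  have : (fun z => a z / s z + (1 + k%:R) * (s z)^-1) @ F --> g + (1 + k%:R) * 0.
    apply: cvgD => //; apply: cvgM; [exact: cvg_cst|exact: invs_cvg0].
  rewrite mulr0 addr0; apply: cvg_trans; apply: near_eq_cvg; apply: nearW => z.
  by rewrite -mulrDl addrA.
have -> : binom_coef n (- g) k.+1 =
    - (n%:R + k%:R) / k.+1%:R * g^-1 * binom_coef n (- g) k.
  rewrite /binom_coef pochhammerS factS natrM exprS.
  have h1 := factS_neq0 R k; have h2 : 1 + k%:R != 0 :> R by rewrite addrC natr1 pnatr_eq0.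
  have h3 : (- g) ^+ k != 0 by rewrite expf_neq0 // oppr_eq0.
  by field; rewrite h1 h2 h3 g0.
have : (fun z => - (n%:R + k%:R) / k.+1%:R * ((a z + 1 + k%:R) / s z)^-1 *
      (s z ^+ k * iter k fdiff (v z) 0%N / k`!%:R)) @ F -->
    - (n%:R + k%:R) / k.+1%:R * g^-1 * binom_coef n (- g) k.
  apply: cvgM => //; apply: cvgM; first exact: cvg_cst.
  exact: cvgV.
apply: cvg_trans; apply: near_eq_cvg.
have vrecs := near_forall_leq k vrec.
near=> z.
have s0 : s z != 0 by rewrite gt_eqF //; near: z; exact: s_gt0.
have ak : a z + 1 + k%:R != 0.
  have : (a z + 1 + k%:R) / s z != 0.
    by near: z; exact: (cvgr_neq0 _ lim g0).
  by apply: contra_neq => ->; rewrite mul0r.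
have vr : forall l, (l <= k)%N ->
     (a z + 1 + l%:R) * (v z l.+1 - v z l) = - n%:R * v z l.
  by near: z; exact: vrecs.
have := @fdiff_recurrence R (v z) 1 (a z + 1) (- n%:R) 0 k 0.
rewrite !mul1r !mul0r !subr0 add0n => H.
have {H} : (a z + 1 + k%:R) * iter k.+1 fdiff (v z) 0 + k%:R * iter k fdiff (v z) 0 =
     - n%:R * iter k fdiff (v z) 0.
  by apply: H => j jk; rewrite !add0n mul1r mul0r subr0; exact: vr.
move=> /(canRL (addrK _)) H.
have -> : iter k.+1 fdiff (v z) 0%N =
    - (n%:R + k%:R) / (a z + 1 + k%:R) * iter k fdiff (v z) 0%N.
  by apply: (mulfI ak); rewrite H; field.
rewrite factS natrM exprS.
have h1 := factS_neq0 R k; have h2 : 1 + k%:R != 0 :> R by rewrite addrC natr1 pnatr_eq0.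
by field; rewrite h1 h2 s0 ak.
Unshelve. all: by end_near. Qed.

(** With t = l / s, the relation kap (A + l) (u(l + 1) - u(l)) = (C - l) u(l)
    discretizes 2 u'(t) = - (c + t) u(t), with the solution
    exp(- c t / 2 - t ^ 2 / 4). *)
Lemma taylor_cvg_hermite (kap c : R) (A C : T -> R) (u : T -> nat -> R) :
  (fun z => kap * A z / s z ^+ 2) @ F --> (2 : R) ->
  (fun z => C z / s z) @ F --> - c -> (\forall z \near F, u z 0%N = 1) ->
  (forall l, \forall z \near F,
     kap * (A z + l%:R) * (u z l.+1 - u z l) = (C z - l%:R) * u z l) ->
  taylor_cvg u (hermite_coef c).
Proof.
move=> limA limC u0 urec.
have inv0 := invs_cvg0.
have limAk k : (fun z => kap * (A z + k%:R) / s z ^+ 2) @ F --> (2 : R).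
  have : (fun z => kap * A z / s z ^+ 2 + kap * k%:R * (s z)^-1 ^+ 2) @ F
      --> 2 + kap * k%:R * 0 ^+ 2.
    by apply: cvgD => //; apply: cvgM; [exact: cvg_cst|exact: cvg_exprn].
  rewrite expr0n mulr0 addr0; apply: cvg_trans; apply: near_eq_cvg.
  by apply: nearW => z; rewrite exprVn; ring.
have limCk k : (fun z => (C z - k%:R - kap * k%:R) / s z) @ F --> - c.
  have : (fun z => C z / s z - (k%:R + kap * k%:R) * (s z)^-1) @ F
      --> - c - (k%:R + kap * k%:R) * 0.
    by apply: cvgB => //; apply: cvgM => //; exact: cvg_cst.
  rewrite mulr0 subr0; apply: cvg_trans; apply: near_eq_cvg.
  by apply: nearW => z; ring.
have urecs m := near_forall_leq m urec.
pose G k z := s z ^+ k * iter k fdiff (u z) 0%N / k`!%:R.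
(* fdiff_recurrence for the rescaled differences, divided by s ^ 2 *)
have Grec k : \forall z \near F, G k.+1 z =
    (kap * (A z + k%:R) / s z ^+ 2)^-1 * k.+1%:R^-1 *
      ((C z - k%:R - kap * k%:R) / s z * G k z - (if k is k'.+1 then G k' z else 0)).
  near=> z.
  have s0 : s z != 0 by rewrite gt_eqF //; near: z; exact: s_gt0.
  have Ak2 : kap * (A z + k%:R) / s z ^+ 2 != 0.
    by near: z; apply: (cvgr_neq0 _ (limAk k)); rewrite pnatr_eq0.
  have Ak : kap * (A z + k%:R) != 0 by apply: contra_neq Ak2 => ->; rewrite mul0r.
  have ur : forall l, (l <= k)%N ->
     kap * (A z + l%:R) * (u z l.+1 - u z l) = (C z - l%:R) * u z l.
    by near: z; exact: urecs.
  have H : kap * (A z + k%:R) * iter k.+1 fdiff (u z) 0 + kap * k%:R * iter k fdiff (u z) 0 =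
     (C z - 1 * k%:R) * iter k fdiff (u z) 0 - 1 * k%:R * iter k.-1 fdiff (u z) 0.
    have := @fdiff_recurrence R (u z) kap (A z) (C z) 1 k 0; rewrite add0n; apply.
    by move=> j jk; rewrite add0n mul1r; exact: ur.
  have h1 := factS_neq0 R k; have h2 : 1 + k%:R != 0 :> R by rewrite addrC natr1 pnatr_eq0.
  have {}H : iter k.+1 fdiff (u z) 0 = (kap * (A z + k%:R))^-1 *
     ((C z - k%:R - kap * k%:R) * iter k fdiff (u z) 0 - k%:R * iter k.-1 fdiff (u z) 0).
    apply: (mulfI Ak); rewrite mulVKf //; move: H; rewrite !mul1r => H.
    by rewrite -[LHS](addrK (kap * k%:R * iter k fdiff (u z) 0)) H; ring.
  have prevE j : s z ^+ j.+1 * (j%:R * iter j.-1 fdiff (u z) 0) / j`!%:R =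
      s z ^+ 2 * (if j is j'.+1 then G j' z else 0).
    case: j => [|j]; first by rewrite !mul0r !mulr0 mul0r.
    rewrite [j.+1.-1]/= factS natrM !exprS /G.
    have h3 := factS_neq0 R j.
    have h4 : 1 + j%:R != 0 :> R by rewrite addrC natr1 pnatr_eq0.
    by field; rewrite h3 h4.
  have s2 : s z ^+ 2 != 0 by rewrite expf_neq0.
  have -> : (if k is k'.+1 then G k' z else 0) =
      s z ^+ k.+1 * (k%:R * iter k.-1 fdiff (u z) 0) / k`!%:R / s z ^+ 2.
    by rewrite prevE mulrAC divff // mul1r.
  rewrite /G H factS natrM exprS.
  move: (iter k.-1 _ _ _) (iter k _ _ _) (kap * (A z + _)) Ak => D1 D0 K K0.
  by field; rewrite s0 K0 h1 h2.
have G0 : G 0%N @ F --> hermite_coef c 0.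
  rewrite hermite_coef0; apply: cvg_near_cst; apply: filterS u0 => z uz.
  by rewrite /G /= uz mulr1 fact0 divr1.
have limV k : (fun z => (kap * (A z + k%:R) / s z ^+ 2)^-1) @ F --> (2^-1 : R).
  by apply: cvgV => //; rewrite pnatr_eq0.
have step k (l : R) : G k @ F --> hermite_coef c k ->
    (fun z => if k is k'.+1 then G k' z else 0) @ F --> l ->
    G k.+1 @ F --> 2^-1 * k.+1%:R^-1 * (- c * hermite_coef c k - l).
  move=> Gk Gl.
  have : (fun z => (kap * (A z + k%:R) / s z ^+ 2)^-1 * k.+1%:R^-1 *
      ((C z - k%:R - kap * k%:R) / s z * G k z - (if k is k'.+1 then G k' z else 0)))
     @ F --> 2^-1 * k.+1%:R^-1 * (- c * hermite_coef c k - l).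
    by apply: cvgM; [apply: cvgM => //; exact: cvg_cst|apply: cvgB => //; exact: cvgM].
  apply: cvg_trans; apply: near_eq_cvg.
  by apply: filterS (Grec k) => z ->.
suff H k : G k @ F --> hermite_coef c k /\ G k.+1 @ F --> hermite_coef c k.+1.
  by move=> k; case: (H k).
elim: k => [|k [IH1 IH2]]; split=> //.
  have -> : hermite_coef c 1 = 2^-1 * 1%:R^-1 * (- c * hermite_coef c 0 - 0).
    by rewrite hermite_coef1 hermite_coef0; field.
  by apply: step => //; exact: cvg_cst.
have -> : hermite_coef c k.+2 =
    2^-1 * k.+2%:R^-1 * (- c * hermite_coef c k.+1 - hermite_coef c k).
  have k0 : k.+2%:R != 0 :> R by rewrite pnatr_eq0.
  apply: (mulfI k0); rewrite hermite_coefS; move: k0; move: (k.+2%:R) => q q0.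
  by field.
exact: step.
Unshelve. all: by end_near. Qed.

End DifferenceLimits.

(** * Hypergeometric sums under the limit *)

Section SumLimit.
Variables (R : realType) (T : Type) (F : set_system T) (FF : Filter F).
Variables (s : T -> R) (sF : s @ F --> +oo).
Variables (p : nat) (c : 'I_p -> R) (c_inj : injective c) (n : 'I_p -> nat) (i : 'I_p).
Variables (ni_ge1 : (1 <= n i)%N) (x : R).

Lemma near_add_neq0 (a : T -> R) (g b : R) : g != 0 ->
  (fun z => a z / s z) @ F --> g -> \forall z \near F, a z + b != 0.
Proof.
move=> g0 ag; have bF : (fun z => b / s z) @ F --> (0 : R).
  by rewrite -(mulr0 b); apply: cvgM; [exact: cvg_cst|exact: invs_cvg0].
have : (fun z => a z / s z + b / s z) @ F --> g by rewrite -(addr0 g); exact: cvgD.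
move=> /(cvgr_neq0 _) /(_ g0); apply: filterS => z; apply: contra_neq.
by rewrite -mulrDl => ->; rewrite mul0r.
Qed.

Lemma taylor_cvg_ratio (a : T -> R) (g : R) m : g != 0 ->
  (fun z => a z / s z) @ F --> g ->
  taylor_cvg F s (fun z l => pochhammer (a z - m%:R + 1) l / pochhammer (a z + 1) l)
    (binom_coef m (- g)).
Proof.
move=> g0 ag; apply: (taylor_cvg_binom FF sF g0 ag) => //.
  by apply: nearW => z; rewrite !pochhammer0 divr1.
move=> l.
have nz : \forall z \near F, a z + (1 + l%:R) != 0 by exact: (near_add_neq0 _ g0 ag).
near=> z.
have al : a z + 1 + l%:R != 0 by rewrite -addrA; near: z.
rewrite !pochhammerS invfM.
move: (pochhammer _ _) (pochhammer _ _)^-1 => A B.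
by field.
Unshelve. all: by end_near. Qed.

(** The sum is an m-th difference with m = n_i - 1 by sum_pochhammer_fdiff, and
    its summand is a product of samples of the functions whose Taylor
    coefficients enter local_residue. *)
Lemma cvg_hypergeometric_sum (u w : T -> nat -> R) :
  taylor_cvg F s u (hermite_coef (c i)) ->
  (forall l, \forall z \near F, w z l = u z l *
     \prod_(q < p | q != i)
       (pochhammer ((c i - c q) * s z - (n q)%:R + 1) l /
        pochhammer ((c i - c q) * s z + 1) l) * (1 + x / s z) ^+ l) ->
  (fun z => s z ^+ (n i).-1 *
     \sum_(l < n i) pochhammer (- (n i)%:R + 1) l / l`!%:R * w z l) @ F
   --> (-1) ^+ (n i).-1 * (n i).-1`!%:R * local_residue c n i x.
Proof.
move=> ucvg wE; set m := (n i).-1.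
pose f (q : 'I_p) z l : R := if q == i then (1 + x / s z) ^+ l else
  pochhammer ((c i - c q) * s z - (n q)%:R + 1) l / pochhammer ((c i - c q) * s z + 1) l.
have s0 := s_gt0 FF sF.
have fcvg q : taylor_cvg F s (f q) (local_coef c n i x q).
  rewrite /f /local_coef; case: eqVneq => qi; first exact: taylor_cvg_exp.
  have g0 : c i - c q != 0 by rewrite subr_eq0 (inj_eq c_inj) eq_sym.
  rewrite -(opprB (c i)).
  apply: (@taylor_cvg_ratio (fun z => (c i - c q) * s z) (c i - c q) (n q) g0).
  by apply: cvg_near_cst; apply: filterS s0 => z sz; rewrite mulfK // gt_eqF.
have wcvg : taylor_cvg F s w (conv (fun k =>
    (\prod_q series_poly k.+1 (local_coef c n i x q))`_k) (hermite_coef (c i))).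
  have prodcvg := taylor_cvg_prod FF sF (fun q (_ : true) => fcvg q).
  have H := taylor_cvgM FF sF prodcvg ucvg.
  apply: (eq_taylor_cvg FF _ H) => l; near=> z.
  have -> : w z l = u z l * \prod_(q < p | q != i)
       (pochhammer ((c i - c q) * s z - (n q)%:R + 1) l /
        pochhammer ((c i - c q) * s z + 1) l) * (1 + x / s z) ^+ l by near: z.
  rewrite mulrC (bigD1 i) //= {1}/f eqxx.
  under eq_bigr => q qi do rewrite /f (negbTE qi).
  by ring.
have -> : (-1) ^+ m * m`!%:R * local_residue c n i x =
    (-1) ^+ m * m`!%:R * conv (fun k =>
    (\prod_q series_poly k.+1 (local_coef c n i x q))`_k) (hermite_coef (c i)) m.
  congr (_ * _); rewrite /local_residue -/m.
  have mE : n i = m.+1 by rewrite /m prednK.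
  rewrite mE coefM; apply: eq_bigr => -[j /=]; rewrite ltnS => jm _.
  rewrite coef_series_poly ?ltnS ?leq_subr //; congr (_ * _).
  apply/esym; apply: (@eqmodX_prod _ _ _ _ j.+1) => // q _.
  exact: eqmodX_series.
have : (fun z => (-1) ^+ m * m`!%:R * (s z ^+ m * iter m fdiff (w z) 0%N / m`!%:R)) @ F -->
   (-1) ^+ m * m`!%:R * conv (fun k =>
    (\prod_q series_poly k.+1 (local_coef c n i x q))`_k) (hermite_coef (c i)) m.
  by apply: cvgM; [exact: cvg_cst|exact: wcvg].
apply: cvg_trans; apply: near_eq_cvg; apply: nearW => z.
have -> : - (n i)%:R + 1 = - m%:R :> R.
  by rewrite -(prednK ni_ge1) -/m -natr1 opprD subrK.
rewrite -(prednK ni_ge1) -/m sum_pochhammer_fdiff.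
have h1 := factS_neq0 R m.
by field.
Unshelve. all: by end_near. Qed.

End SumLimit.

(** * The limits *)

Section Prefactors.
Variable R : realType.

Lemma cvg_pochhammer_scaled (T : Type) (F : set_system T) (FF : Filter F)
    (X t : T -> R) (L : R) k :
  t @ F --> +oo -> (fun z => X z / t z) @ F --> L ->
  (fun z => pochhammer (X z) k / t z ^+ k) @ F --> L ^+ k.
Proof.
move=> tF XF; elim: k => [|k IH].
  apply: cvg_near_cst; apply: nearW => z.
  by rewrite pochhammer0 !expr0 divr1.
have Xk : (fun z => X z / t z + k%:R / t z) @ F --> L.
  rewrite -[X in _ --> X]addr0 -[X in _ + X](mulr0 k%:R); apply: cvgD => //.
  by apply: cvgM; [exact: cvg_cst|exact: cvg_inv_pinfty].
have : (fun z => pochhammer (X z) k / t z ^+ k * (X z / t z + k%:R / t z)) @ F --> L ^+ k * L.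
  exact: cvgM.
rewrite -exprSr; apply: cvg_trans; apply: near_eq_cvg; apply: nearW => z.
by rewrite pochhammerS exprSr invfM -mulrDl; ring.
Qed.

Lemma sqrt_pinfty : (fun z : R => Num.sqrt z) @ +oo --> +oo.
Proof. by apply: cvg_sqrt_pinfty; exact: cvg_id. Qed.

Lemma cvg_scaled_pinfty (a : R) : 0 < a -> (fun z : R => a * z) @ +oo --> +oo.
Proof. by move=> a0; apply: gt0_cvgMry => //; exact: cvg_id. Qed.

Lemma cvg_over_pinfty (T : Type) (F : set_system T) (FF : Filter F)
  (t : T -> R) (a : R) : t @ F --> +oo -> (fun z => a / t z) @ F --> (0 : R).
Proof.
move=> tF; rewrite -(mulr0 a); apply: cvgM; first exact: cvg_cst.
exact: cvg_inv_pinfty.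
Qed.

Lemma sqrt2M : Num.sqrt 2 * Num.sqrt 2 = 2 :> R.
Proof. by rewrite -expr2 sqr_sqrtr. Qed.

(** Gamma(a + b) / (Gamma(a) Gamma(b)) at a = b + c sqrt(b), up to a bounded
    shift; the exponentials of Stirling's formula cancel, which leaves the
    powers of 2 and the Gaussian factor. *)
Lemma cvg_beta_ratio (c : R) (k : nat) :
  (fun b : R => Num.sqrt b *
     (Gamma (b + c * Num.sqrt b + b + k.+1%:R) /
       (Gamma (b + k.+1%:R) * Gamma (b + c * Num.sqrt b + 1)))
     / 2 `^ (2 * b + c * Num.sqrt b)) @ +oo
  --> 2 ^+ k * expR (- (c ^+ 2 / 4)) / Num.sqrt pi.
Proof.
have s2_gt0 : 0 < Num.sqrt 2 :> R by rewrite sqrtr_gt0.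
have sp_gt0 : 0 < Num.sqrt pi :> R by rewrite sqrtr_gt0 pi_gt0.
have w1 : (fun b : R => (c * Num.sqrt b + k%:R) / Num.sqrt (2 * b)) @ +oo
    --> c / Num.sqrt 2.
  have : (fun b : R => c / Num.sqrt 2 + (k%:R / Num.sqrt 2) / Num.sqrt b) @ +oo
      --> c / Num.sqrt 2 + 0.
    by apply: cvgD; [exact: cvg_cst|exact: cvg_over_pinfty sqrt_pinfty].
  rewrite addr0; apply: cvg_trans; apply: near_eq_cvg; near=> b.
  have b0 : 0 < b by near: b; exact: nbhs_pinfty_gt.
  rewrite sqrtrM //; have sb : Num.sqrt b != 0 by rewrite gt_eqF // sqrtr_gt0.
  by field; rewrite sb gt_eqF.
have w2 : (fun b : R => k%:R / Num.sqrt b) @ +oo --> (0 : R).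
  exact: cvg_over_pinfty sqrt_pinfty.
pose G1 (b : R) :=
   Gamma (2 * b + (c * Num.sqrt b + k%:R) / Num.sqrt (2 * b) * Num.sqrt (2 * b) + 1) /
   ((2 * b) `^ (2 * b + (c * Num.sqrt b + k%:R) / Num.sqrt (2 * b) * Num.sqrt (2 * b)) *
    expR (- (2 * b)) * Num.sqrt (2 * b)).
pose G2 (b : R) := Gamma (b + k%:R / Num.sqrt b * Num.sqrt b + 1) /
   (b `^ (b + k%:R / Num.sqrt b * Num.sqrt b) * expR (- b) * Num.sqrt b).
pose G3 (b : R) := Gamma (b + c * Num.sqrt b + 1) /
   (b `^ (b + c * Num.sqrt b) * expR (- b) * Num.sqrt b).
have R1 : G1 b @[b --> +oo] --> Num.sqrt (2 * pi) * expR ((c / Num.sqrt 2) ^+ 2 / 2).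
  exact: cvg_Gamma_shift (cvg_scaled_pinfty (ltr0Sn R 1)) w1.
have R2 : G2 b @[b --> +oo] --> Num.sqrt (2 * pi) * expR (0 ^+ 2 / 2).
  exact: cvg_Gamma_shift cvg_id w2.
have R3 : G3 b @[b --> +oo] --> Num.sqrt (2 * pi) * expR (c ^+ 2 / 2).
  by apply: (@cvg_Gamma_shift _ _ _ _ id (fun=> c)); [exact: cvg_id|exact: cvg_cst].
have s2p : Num.sqrt (2 * pi) = Num.sqrt 2 * Num.sqrt pi :> R by rewrite sqrtrM.
have : G1 b / (G2 b * G3 b) * (2 ^+ k * Num.sqrt 2) @[b --> +oo] -->
   Num.sqrt (2 * pi) * expR ((c / Num.sqrt 2) ^+ 2 / 2) /
    (Num.sqrt (2 * pi) * expR (0 ^+ 2 / 2) * (Num.sqrt (2 * pi) * expR (c ^+ 2 / 2)))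
    * (2 ^+ k * Num.sqrt 2).
  apply: cvgM; last exact: cvg_cst.
  apply: cvgM => //; apply: cvgV; last exact: cvgM.
  by rewrite s2p !mulf_neq0 ?gt_eqF ?expR_gt0.
have -> : Num.sqrt (2 * pi) * expR ((c / Num.sqrt 2) ^+ 2 / 2) /
    (Num.sqrt (2 * pi) * expR (0 ^+ 2 / 2) * (Num.sqrt (2 * pi) * expR (c ^+ 2 / 2)))
    * (2 ^+ k * Num.sqrt 2) = 2 ^+ k * expR (- (c ^+ 2 / 4)) / Num.sqrt pi.
  rewrite expr0n mul0r expR0 mulr1 expr_div_n [Num.sqrt 2 ^+ 2]expr2 sqrt2M s2p.
  have -> : c ^+ 2 / 2 = c ^+ 2 / 4 + c ^+ 2 / 4 by lra.
  have -> : (c ^+ 2 / 4 + c ^+ 2 / 4) / 2 = c ^+ 2 / 4 by lra.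
  rewrite expRN expRD; have e0 := expR_gt0 (c ^+ 2 / 4).
  by field; rewrite !gt_eqF.
apply: cvg_trans; apply: near_eq_cvg; near=> b.
have b0 : 0 < b by near: b; exact: nbhs_pinfty_gt.
have sb : 0 < Num.sqrt b by rewrite sqrtr_gt0.
have s2b : Num.sqrt (2 * b) = Num.sqrt 2 * Num.sqrt b by rewrite sqrtrM.
rewrite /G1 /G2 /G3 divfK ?gt_eqF //; last by rewrite s2b mulr_gt0.
rewrite [k%:R / _ * _]divfK ?gt_eqF //.
have -> : 2 * b + (c * Num.sqrt b + k%:R) + 1 = b + c * Num.sqrt b + b + k.+1%:R.
  by rewrite -natr1; ring.
rewrite -[b + k%:R + 1]addrA natr1.
have -> : 2 * b + (c * Num.sqrt b + k%:R) = (2 * b + c * Num.sqrt b) + k%:R by ring.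
have powE : (2 * b) `^ (2 * b + c * Num.sqrt b + k%:R) =
   2 `^ (2 * b + c * Num.sqrt b) * 2 ^+ k * (b `^ (b + k%:R) * b `^ (b + c * Num.sqrt b)).
  have bn0 : b != 0 by rewrite gt_eqF.
  rewrite powRM // ?ltW //; congr (_ * _).
    by rewrite powRD ?powR_mulrn // pnatr_eq0 implybT.
  by rewrite -powRD ?bn0 ?implybT //; congr (b `^ _); ring.
have -> : expR (- (2 * b)) = expR (- b) * expR (- b) by rewrite -expRD; congr expR; ring.
rewrite powE s2b.
have h1 := powR_gt0 (2 * b + c * Num.sqrt b) (ltr0Sn R 1).
have h2 := powR_gt0 (b + k%:R) b0; have h3 := powR_gt0 (b + c * Num.sqrt b) b0.
have h4 := expR_gt0 (- b).
move: (Gamma _) (Gamma (b + k.+1%:R)) (Gamma (b + c * Num.sqrt b + 1)) => Ga Gb Gc.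
rewrite !invfM !invrK; move: Gb^-1 Gc^-1 => Gb' Gc'.
have k2 : 2 ^+ k != 0 :> R by rewrite expf_neq0 // pnatr_eq0.
by field; rewrite k2 !gt_eqF.
Unshelve. all: by end_near. Qed.

End Prefactors.

Section Limits.
Variables (R : realType) (p : nat) (c : 'I_p -> R) (c_inj : injective c).
Variables (n : 'I_p -> nat) (i : 'I_p) (ni_ge1 : (1 <= n i)%N) (x : R).
Let N := vsize n.

Lemma cvg_prod_pred (T : Type) (F : set_system T) (FF : Filter F) (I : finType)
    (P : pred I) (f : I -> T -> R) (l : I -> R) :
  (forall q, P q -> f q @ F --> l q) ->
  (fun z => \prod_(q | P q) f q z) @ F --> \prod_(q | P q) l q.
Proof.
move=> fl; elim: (index_enum I) => [|q r IH].
  rewrite big_nil; apply: cvg_near_cst; apply: nearW => z.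
  by rewrite big_nil.
rewrite big_cons; case: (boolP (P q)) => Pq.
  have : (fun z => f q z * \prod_(j <- r | P j) f j z) @ F -->
      l q * \prod_(j <- r | P j) l j.
    by apply: cvgM => //; exact: fl.
  apply: cvg_trans; apply: near_eq_cvg.
  by apply: nearW => z /=; rewrite big_cons Pq.
move: IH; apply: cvg_trans; apply: near_eq_cvg.
by apply: nearW => z; rewrite big_cons (negbTE Pq).
Qed.

Let m := (n i).-1.

Lemma vsize_split : N.-1 = (m + \sum_(q | q != i) n q)%N.
Proof. by rewrite /N /vsize (bigD1 i) //= -(prednK ni_ge1) addSn. Qed.

(** Both prefactors contain this quotient, as alpha_q - alpha_i = (c_q - c_i) s
    in both limits. Passing from c_q - c_i to c_i - c_q turns the sign
    (-1) ^ (N - 1) into (-1) ^ (n_i - 1). *)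
Lemma cvg_node_product (T : Type) (F : set_system T) (FF : Filter F) (s : T -> R) :
  s @ F --> +oo ->
  (fun z => (-1) ^+ N.-1 / m`!%:R /
     ((\prod_(q < p | q != i) pochhammer ((c q - c i) * s z) (n q)) /
        s z ^+ \sum_(q | q != i) n q)) @ F
  --> (-1) ^+ m / m`!%:R / \prod_(q < p | q != i) (c i - c q) ^+ n q.
Proof.
move=> sF; have cq q : q != i -> c q - c i != 0.
  by move=> qi; rewrite subr_eq0 (inj_eq c_inj).
have -> : (-1) ^+ m / m`!%:R / \prod_(q < p | q != i) (c i - c q) ^+ n q =
    (-1) ^+ N.-1 / m`!%:R / \prod_(q < p | q != i) (c q - c i) ^+ n q.
  have -> : \prod_(q < p | q != i) (c q - c i) ^+ n q =
     (-1) ^+ (\sum_(q | q != i) n q) * \prod_(q < p | q != i) (c i - c q) ^+ n q.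
    rewrite -prodrXr -big_split /=; apply: eq_bigr => q _.
    by rewrite -exprMn mulN1r opprB.
  have D0 : \prod_(q < p | q != i) (c i - c q) ^+ n q != 0.
    rewrite prodf_seq_neq0; apply/allP => q _; apply/implyP => qi.
    by rewrite expf_neq0 // -oppr_eq0 opprB cq.
  have s0 : (-1) ^+ (\sum_(q | q != i) n q) != 0 :> R by rewrite signr_eq0.
  rewrite vsize_split exprD; have h1 := factS_neq0 R m.
  by field; rewrite h1 D0 s0.
apply: cvgM; first exact: cvg_cst.
apply: cvgV.
  rewrite prodf_seq_neq0; apply/allP => q _; apply/implyP => /cq.
  exact: expf_neq0.
have : (fun z => \prod_(q < p | q != i) (pochhammer ((c q - c i) * s z) (n q) / s z ^+ n q)) @ F
   --> \prod_(q < p | q != i) (c q - c i) ^+ n q.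
  apply: cvg_prod_pred => q qi; apply: cvg_pochhammer_scaled => //.
  apply: cvg_near_cst; apply: filterS (s_gt0 _ sF) => z sz.
  by rewrite mulfK // gt_eqF.
apply: cvg_trans; apply: near_eq_cvg; apply: nearW => z.
by rewrite prodf_div prodrXr.
Qed.

Let target := leading_factor c n i * local_residue c n i x.

(** With s = sqrt(beta / 2), the ratio beta ^ l / (alpha_i + 1)_l is sampled by
    taylor_cvg_hermite with kap = 1, and the remaining powers of the argument
    beta (1 + x / s) by taylor_cvg_exp. *)
Lemma cvg_laguerre :
  Num.sqrt (2 * beta) ^+ vsize n
    * beta `^ (beta + c i * Num.sqrt (beta / 2)) * expR (- beta)
    * (multiple_laguerreI n
         (fun q => beta + c q * Num.sqrt (beta / 2)) i).[
         Num.sqrt (2 * beta) * x + beta]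
  @[beta --> +oo%R] --> target.
Proof.
pose s (b : R) : R := Num.sqrt (b / 2).
have sF : s b @[b --> +oo] --> +oo.
  apply: cvg_sqrt_pinfty; apply: gt0_cvgMly; [by rewrite invr_gt0|exact: cvg_id].
pose B (b : R) : R := b + c i * s b + 1.
pose u (b : R) (l : nat) : R := b ^+ l / pochhammer (B b) l.
have bE (b : R) : 0 < b -> b = 2 * s b ^+ 2.
  by move=> b0; rewrite sqr_sqrtr ?divr_ge0 ?ltW // mulrC divfK.
have ss (b : R) : 0 < b -> 0 < s b by move=> b0; rewrite sqrtr_gt0 divr_gt0.
have bpos : \forall b \near +oo, 0 < b :> R by exact: nbhs_pinfty_gt.
have is0 (a : R) : a / s b @[b --> +oo] --> (0 : R) by exact: cvg_over_pinfty.
have Bs : B b / s b ^+ 2 @[b --> +oo] --> (2 : R).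
  have : 2 + c i / s b + (1 / s b) * (1 / s b) @[b --> +oo] --> (2 + 0 + 0 * 0 : R).
    by apply: cvgD; [apply: cvgD => //; exact: cvg_cst|exact: cvgM].
  rewrite mulr0 !addr0; apply: cvg_trans; apply: near_eq_cvg; near=> b.
  have b0 : 0 < b by near: b.
  rewrite /B; move: (ss b b0) (bE b b0); move: (s b) => r r0 ->.
  by field; rewrite gt_eqF.
have Bpos l : \forall b \near +oo, 0 < B b + l%:R.
  have Bs0 : \forall b \near +oo, 0 < B b / s b ^+ 2 by apply: (cvgr_gt 2).
  near=> b; have b0 : 0 < b by near: b.
  apply: ltr_wpDr => //; have : 0 < B b / s b ^+ 2 by near: b.
  by rewrite pmulr_lgt0 // invr_gt0 exprn_gt0 // ss.
have ucvg : taylor_cvg +oo s u (hermite_coef (c i)).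
  apply: (@taylor_cvg_hermite _ _ _ _ _ sF 1 (c i) B (fun b => b - B b)).
  - by under eq_fun do rewrite mul1r.
  - have : - c i - 1 / s b @[b --> +oo] --> - c i - 0.
      by apply: cvgB => //; exact: cvg_cst.
    rewrite subr0; apply: cvg_trans; apply: near_eq_cvg; near=> b.
    have b0 : 0 < b by near: b.
    rewrite /B; have sb := ss b b0.
    by field; rewrite gt_eqF.
  - by apply: nearW => b; rewrite /u pochhammer0 divr1.
  - move=> l; near=> b.
    have Bl : 0 < B b + l%:R by near: b.
    rewrite /u pochhammerS exprSr invfM mul1r.
    move: (_ ^+ _) (pochhammer _ _)^-1 => X Y.
    by field; rewrite gt_eqF.
pose w (b : R) (l : nat) : R := u b l * \prod_(q < p | q != i)
       (pochhammer ((c i - c q) * s b - (n q)%:R + 1) l /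
        pochhammer ((c i - c q) * s b + 1) l) * (1 + x / s b) ^+ l.
have sumcvg := @cvg_hypergeometric_sum _ _ _ _ _ sF _ _ c_inj n _ ni_ge1 x u w ucvg
  (fun l => nearW _ (fun z => erefl)).
have pre := cvg_node_product _ sF.
pose G (b : R) : R := Gamma (b + c i * s b + 1) / (b `^ (b + c i * s b) * expR (- b) * Num.sqrt b).
have Gcvg : G b @[b --> +oo] --> Num.sqrt (2 * pi) * expR ((c i / Num.sqrt 2) ^+ 2 / 2).
  have : Gamma (b + c i / Num.sqrt 2 * Num.sqrt b + 1) /
      (b `^ (b + c i / Num.sqrt 2 * Num.sqrt b) * expR (- b) * Num.sqrt b) @[b --> +oo] -->
      Num.sqrt (2 * pi) * expR ((c i / Num.sqrt 2) ^+ 2 / 2).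
    by apply: (@cvg_Gamma_shift _ _ _ _ id (fun=> c i / Num.sqrt 2));
      [exact: cvg_id|exact: cvg_cst].
  apply: cvg_trans; apply: near_eq_cvg; near=> b.
  have b0 : 0 < b by near: b.
  have -> : c i / Num.sqrt 2 * Num.sqrt b = c i * s b.
    by rewrite /s sqrtrM ?ltW // sqrtrV // -mulrA [_^-1 * _]mulrC.
  by [].
have s2_gt0 : 0 < Num.sqrt 2 :> R by rewrite sqrtr_gt0.
have sp_gt0 : 0 < Num.sqrt pi :> R by rewrite sqrtr_gt0 pi_gt0.
have s2p : Num.sqrt (2 * pi) = Num.sqrt 2 * Num.sqrt pi :> R by rewrite sqrtrM.
have D0 : \prod_(q < p | q != i) (c i - c q) ^+ n q != 0.
  rewrite prodf_seq_neq0; apply/allP => q _; apply/implyP => qi.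
  by rewrite expf_neq0 // subr_eq0 (inj_eq c_inj) eq_sym.
have N1 : N = N.-1.+1 by rewrite prednK // (leq_trans ni_ge1) // le_vsize.
have h1 := factS_neq0 R m.
have -> : target = (-1) ^+ m / m`!%:R / \prod_(q < p | q != i) (c i - c q) ^+ n q
   * (Num.sqrt (2 * pi) * expR ((c i / Num.sqrt 2) ^+ 2 / 2))^-1
   * (2 ^+ N / Num.sqrt 2) * ((-1) ^+ m * m`!%:R * local_residue c n i x).
  rewrite /target /leading_factor -/N {2}N1 [2 ^+ N.-1.+1]exprS s2p expr_div_n.
  rewrite [Num.sqrt 2 ^+ 2]expr2 sqrt2M.
  have -> : c i ^+ 2 / 2 / 2 = c i ^+ 2 / 4 by lra.
  rewrite expRN; have e0 := expR_gt0 (c i ^+ 2 / 4).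
  have sg : (-1) ^+ m * (-1) ^+ m = 1 :> R by rewrite -expr2 sqrr_sign.
  move: (local_residue _ _ _ _) (2 ^+ N.-1) => L P; move: (\prod_(q | _) _) D0 => D D0.
  have s22 := sqrt2M R; set E := expR _ in e0 *.
  transitivity (((-1) ^+ m * (-1) ^+ m) * (2 / (Num.sqrt 2 * Num.sqrt 2)) *
     (P / Num.sqrt pi * E^-1 / D * L)).
    by rewrite sg s22 divff ?pnatr_eq0 // !mul1r.
  by field; rewrite h1 D0 !gt_eqF.
have : (-1) ^+ N.-1 / m`!%:R /
     ((\prod_(q < p | q != i) pochhammer ((c q - c i) * s b) (n q)) /
        s b ^+ \sum_(q | q != i) n q) * (G b)^-1 * (2 ^+ N / Num.sqrt 2) *
     (s b ^+ m * \sum_(l < n i) pochhammer (- (n i)%:R + 1) l / l`!%:R * w b l) @[b --> +oo] -->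
   (-1) ^+ m / m`!%:R / \prod_(q < p | q != i) (c i - c q) ^+ n q
   * (Num.sqrt (2 * pi) * expR ((c i / Num.sqrt 2) ^+ 2 / 2))^-1
   * (2 ^+ N / Num.sqrt 2) * ((-1) ^+ m * m`!%:R * local_residue c n i x).
  apply: cvgM; last exact: sumcvg.
  apply: cvgM; last exact: cvg_cst.
  apply: cvgM; first exact: pre.
  apply: cvgV => //.
  by rewrite s2p !mulf_neq0 ?gt_eqF ?expR_gt0.
apply: cvg_trans; apply: near_eq_cvg; near=> b.
have b0 : 0 < b by near: b.
have sb := ss b b0; have bs := bE b b0.
have s2b : Num.sqrt (2 * b) = 2 * s b.
  by rewrite {1}bs mulrA -expr2 -exprMn sqrtr_sqr ger0_norm // mulr_ge0 // ltW.
have sqb : Num.sqrt b = Num.sqrt 2 * s b.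
  by rewrite {1}bs sqrtrM // sqrtr_sqr ger0_norm // ltW.
have sumE : (\sum_(l < n i)
       (pochhammer (- (n i)%:R + 1) l
        / (l`!%:R * pochhammer (B b) l)
        * \prod_(q < p | q != i)
            (pochhammer ((b + c i * s b) - (b + c q * s b) - (n q)%:R + 1) l
             / pochhammer ((b + c i * s b) - (b + c q * s b) + 1) l))
       *: 'X^l).[Num.sqrt (2 * b) * x + b] =
    \sum_(l < n i) pochhammer (- (n i)%:R + 1) l / l`!%:R * w b l.
  rewrite horner_sum; apply: eq_bigr => l _; rewrite hornerZ hornerXn /w /u.
  have -> : Num.sqrt (2 * b) * x + b = b * (1 + x / s b).
    rewrite s2b; move: sb bs; move: (s b) => r r0 ->.
    by field; rewrite gt_eqF.
  rewrite exprMn invfM.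
  have -> : \prod_(q < p | q != i)
            (pochhammer ((b + c i * s b) - (b + c q * s b) - (n q)%:R + 1) l
             / pochhammer ((b + c i * s b) - (b + c q * s b) + 1) l) =
     \prod_(q < p | q != i)
       (pochhammer ((c i - c q) * s b - (n q)%:R + 1) l /
        pochhammer ((c i - c q) * s b + 1) l).
    apply: eq_bigr => q _.
    by have -> : (b + c i * s b) - (b + c q * s b) = (c i - c q) * s b by ring.
  by ring.
rewrite /multiple_laguerreI hornerZ -/(s b) -/(B b) sumE.
move: (\sum_(l < n i) _) => S.
have -> : \prod_(q < p | q != i) pochhammer (b + c q * s b - (b + c i * s b)) (n q) =
    \prod_(q < p | q != i) pochhammer ((c q - c i) * s b) (n q).
  by apply: eq_bigr => q _; congr (pochhammer _ _); ring.
have sN : s b ^+ N = s b * (s b ^+ m * s b ^+ (\sum_(q | q != i) n q)).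
  by rewrite {1}N1 vsize_split exprS exprD.
rewrite -/N -/m /G s2b sqb exprMn sN -/(B b).
have e0 := expR_gt0 (- b); have P0 := powR_gt0 (b + c i * s b) b0.
move: (\prod_(q | _) _) (Gamma _) (_ `^ _) P0 (expR _) e0 => D Ga P P0 E E0.
rewrite !invfM !invrK; move: D^-1 Ga^-1 => D' Ga'.
by field; rewrite h1 gt_eqF.
Unshelve. all: by end_near. Qed.

(** With s = sqrt(beta), the argument is (1 + x / s) / 2, and the ratio
    (alpha_i + beta + N)_l / (2 ^ l (alpha_i + 1)_l) is sampled by
    taylor_cvg_hermite with kap = 2. *)
Lemma cvg_jacobi_pineiro :
  1 / ((2 * Num.sqrt beta) ^+ vsize n
       * 2 `^ (2 * beta + c i * Num.sqrt beta))
    * (jacobi_pineiroI n (fun q => beta + c q * Num.sqrt beta) beta i).[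
         (x + Num.sqrt beta) / (2 * Num.sqrt beta)]
  @[beta --> +oo%R] --> target.
Proof.
pose s (b : R) : R := Num.sqrt b.
have sF : s b @[b --> +oo] --> +oo by exact: sqrt_pinfty.
pose A (q : 'I_p) (b : R) : R := b + c q * s b + b + N%:R.
pose B (b : R) : R := b + c i * s b + 1.
pose u (b : R) (l : nat) : R := pochhammer (A i b) l / (pochhammer (B b) l * 2 ^+ l).
have bE (b : R) : 0 < b -> b = s b ^+ 2 by move=> b0; rewrite sqr_sqrtr ?ltW.
have ss (b : R) : 0 < b -> 0 < s b by move=> b0; rewrite sqrtr_gt0.
have bpos : \forall b \near +oo, 0 < b :> R by exact: nbhs_pinfty_gt.
have is0 (a : R) : a / s b @[b --> +oo] --> (0 : R) by exact: cvg_over_pinfty.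
have Bs : B b / s b ^+ 2 @[b --> +oo] --> (1 : R).
  have : 1 + c i / s b + (1 / s b) * (1 / s b) @[b --> +oo] --> (1 + 0 + 0 * 0 : R).
    by apply: cvgD; [apply: cvgD => //; exact: cvg_cst|exact: cvgM].
  rewrite mulr0 !addr0; apply: cvg_trans; apply: near_eq_cvg; near=> b.
  have b0 : 0 < b by near: b.
  rewrite /B; move: (ss b b0) (bE b b0); move: (s b) => r r0 ->.
  by field; rewrite gt_eqF.
have Bpos l : \forall b \near +oo, 0 < B b + l%:R.
  have Bs0 : \forall b \near +oo, 0 < B b / s b ^+ 2 by apply: (cvgr_gt 1).
  near=> b; have b0 : 0 < b by near: b.
  apply: ltr_wpDr => //; have : 0 < B b / s b ^+ 2 by near: b.
  by rewrite pmulr_lgt0 // invr_gt0 exprn_gt0 // ss.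
have ucvg : taylor_cvg +oo s u (hermite_coef (c i)).
  apply: (@taylor_cvg_hermite _ _ _ _ _ sF 2 (c i) B (fun b => A i b - 2 * B b)).
  - rewrite -[X in _ --> X](mulr1 2); under eq_fun do rewrite -mulrA.
    by apply: cvgM => //; exact: cvg_cst.
  - have : - c i + (N%:R - 2) / s b @[b --> +oo] --> - c i + 0.
      by apply: cvgD => //; exact: cvg_cst.
    rewrite addr0; apply: cvg_trans; apply: near_eq_cvg; near=> b.
    have b0 : 0 < b by near: b.
    rewrite /A /B; have sb := ss b b0.
    by field; rewrite gt_eqF.
  - by apply: nearW => b; rewrite /u !pochhammer0 expr0 mulr1 divr1.
  - move=> l; near=> b.
    have Bl : 0 < B b + l%:R by near: b.
    have l2 : 2 ^+ l != 0 :> R by rewrite expf_neq0 // pnatr_eq0.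
    rewrite /u !pochhammerS exprSr !invfM.
    move: (pochhammer (A i b) _) (pochhammer (B b) _)^-1 => X Y.
    by field; rewrite l2 gt_eqF.
pose w (b : R) (l : nat) : R := u b l * \prod_(q < p | q != i)
       (pochhammer ((c i - c q) * s b - (n q)%:R + 1) l /
        pochhammer ((c i - c q) * s b + 1) l) * (1 + x / s b) ^+ l.
have sumcvg := @cvg_hypergeometric_sum _ _ _ _ _ sF _ _ c_inj n _ ni_ge1 x u w ucvg
  (fun l => nearW _ (fun z => erefl)).
have pre := cvg_node_product _ sF.
have N1 : N = N.-1.+1 by rewrite prednK // (leq_trans ni_ge1) // le_vsize.
have Gcvg := @cvg_beta_ratio R (c i) N.-1; rewrite -N1 in Gcvg.
have Acvg : (\prod_q pochhammer (A q b) (n q)) / b ^+ N @[b --> +oo] --> (2 ^+ N : R).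
  have : \prod_q (pochhammer (A q b) (n q) / b ^+ n q) @[b --> +oo] -->
      \prod_q (2 ^+ n q : R).
    apply: cvg_prod_pred => q _; apply: cvg_pochhammer_scaled; first exact: cvg_id.
    have : 2 + c q / s b + N%:R / b @[b --> +oo] --> (2 + 0 + 0 : R).
      apply: cvgD; last by apply: cvg_over_pinfty; exact: cvg_id.
      by apply: cvgD => //; exact: cvg_cst.
    rewrite !addr0; apply: cvg_trans; apply: near_eq_cvg; near=> b.
    have b0 : 0 < b by near: b.
    rewrite /A; move: (ss b b0) (bE b b0); move: (s b) => r r0 ->.
    by field; rewrite gt_eqF.
  rewrite prodrXr -/(vsize n) -/N; apply: cvg_trans; apply: near_eq_cvg.
  by apply: nearW => b; rewrite prodf_div prodrXr.
have sp_gt0 : 0 < Num.sqrt pi :> R by rewrite sqrtr_gt0 pi_gt0.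
have D0 : \prod_(q < p | q != i) (c i - c q) ^+ n q != 0.
  rewrite prodf_seq_neq0; apply/allP => q _; apply/implyP => qi.
  by rewrite expf_neq0 // subr_eq0 (inj_eq c_inj) eq_sym.
have h1 := factS_neq0 R m.
have N2 : 2 ^+ N != 0 :> R by rewrite expf_neq0 // pnatr_eq0.
have -> : target = (-1) ^+ m / m`!%:R / \prod_(q < p | q != i) (c i - c q) ^+ n q
   * (2 ^+ N.-1 * expR (- (c i ^+ 2 / 4)) / Num.sqrt pi)
   * (2 ^+ N / 2 ^+ N) * ((-1) ^+ m * m`!%:R * local_residue c n i x).
  rewrite /target /leading_factor -/N (divff N2).
  have sg : (-1) ^+ m * (-1) ^+ m = 1 :> R by rewrite -expr2 sqrr_sign.
  move: (local_residue _ _ _ _) (2 ^+ N.-1) (expR _) => L P E.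
  move: (\prod_(q | _) _) D0 => D D0.
  transitivity (((-1) ^+ m * (-1) ^+ m) * (P / Num.sqrt pi * E / D * L)).
    by rewrite sg !mul1r.
  by field; rewrite h1 D0 !gt_eqF.
have : (-1) ^+ N.-1 / m`!%:R /
     ((\prod_(q < p | q != i) pochhammer ((c q - c i) * s b) (n q)) /
        s b ^+ \sum_(q | q != i) n q) *
     (s b * (Gamma (A i b) / (Gamma (b + N%:R) * Gamma (B b)))
        / 2 `^ (2 * b + c i * s b)) *
     ((\prod_q pochhammer (A q b) (n q)) / b ^+ N / 2 ^+ N) *
     (s b ^+ m * \sum_(l < n i) pochhammer (- (n i)%:R + 1) l / l`!%:R * w b l) @[b --> +oo] -->
   (-1) ^+ m / m`!%:R / \prod_(q < p | q != i) (c i - c q) ^+ n q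
   * (2 ^+ N.-1 * expR (- (c i ^+ 2 / 4)) / Num.sqrt pi)
   * (2 ^+ N / 2 ^+ N) * ((-1) ^+ m * m`!%:R * local_residue c n i x).
  apply: cvgM; last exact: sumcvg.
  apply: cvgM; last by apply: cvgM; [exact: Acvg|exact: cvg_cst].
  by apply: cvgM; [exact: pre|exact: Gcvg].
apply: cvg_trans; apply: near_eq_cvg; near=> b.
have b0 : 0 < b by near: b.
have sb := ss b b0; have bs := bE b b0.
have sumE : (\sum_(l < n i)
       (pochhammer (- (n i)%:R + 1) l * pochhammer (A i b) l
        / (l`!%:R * pochhammer (B b) l)
        * \prod_(q < p | q != i)
            (pochhammer ((b + c i * s b) - (b + c q * s b) - (n q)%:R + 1) l
             / pochhammer ((b + c i * s b) - (b + c q * s b) + 1) l))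
       *: 'X^l).[(x + s b) / (2 * s b)] =
    \sum_(l < n i) pochhammer (- (n i)%:R + 1) l / l`!%:R * w b l.
  rewrite horner_sum; apply: eq_bigr => l _; rewrite hornerZ hornerXn /w /u.
  have -> : (x + s b) / (2 * s b) = (1 + x / s b) / 2 by field; rewrite gt_eqF.
  rewrite expr_div_n !invfM.
  have -> : \prod_(q < p | q != i)
            (pochhammer ((b + c i * s b) - (b + c q * s b) - (n q)%:R + 1) l
             / pochhammer ((b + c i * s b) - (b + c q * s b) + 1) l) =
     \prod_(q < p | q != i)
       (pochhammer ((c i - c q) * s b - (n q)%:R + 1) l /
        pochhammer ((c i - c q) * s b + 1) l).
    apply: eq_bigr => q _.
    by have -> : (b + c i * s b) - (b + c q * s b) = (c i - c q) * s b by ring.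
  by ring.
rewrite /jacobi_pineiroI hornerZ -/(s b) -/N -/(A i b) -/(B b) sumE.
move: (\sum_(l < n i) _) => S.
have -> : \prod_(q < p | q != i) pochhammer (b + c q * s b - (b + c i * s b)) (n q) =
    \prod_(q < p | q != i) pochhammer ((c q - c i) * s b) (n q).
  by apply: eq_bigr => q _; congr (pochhammer _ _); ring.
have sN : s b ^+ N = s b * (s b ^+ m * s b ^+ (\sum_(q | q != i) n q)).
  by rewrite {1}N1 vsize_split exprS exprD.
have bN : b ^+ N = s b ^+ N * s b ^+ N by rewrite {1}bs -exprM mulnC mulnS muln1 exprD.
rewrite bN exprMn sN -/m.
have P0 := powR_gt0 (2 * b + c i * s b) (ltr0Sn R 1).
move: (\prod_(q < p) _) (\prod_(q < p | _) _) => D1 D.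
move: (Gamma (A i b)) (Gamma (b + N%:R)) (Gamma (B b)) (_ `^ _) P0 => Ga Gb Gc P P0.
rewrite !invfM !invrK; move: D^-1 Gb^-1 Gc^-1 => D' Gb' Gc'.
by field; rewrite h1 N2 !gt_eqF ?exprn_gt0.
Unshelve. all: by end_near. Qed.

End Limits.

Theorem theorem5p1 (R : realType) (p : nat) (c : 'I_p -> R)
    (c_inj : injective c) (n : 'I_p -> nat) (i : 'I_p) (ni_ge1 : (1 <= n i)%N)
    (x : R) :
  [/\ (multiple_hermiteI n c i).[x] =
        (-1) ^+ (n i).-1 / (Num.sqrt pi * (n i).-1`!%:R)
        * (2 ^+ (vsize n).-1 * expR (- (c i ^+ 2 / 4))
           / \prod_(q < p | q != i) (c i - c q) ^+ n q)
        * \sum_(l : {ffun 'I_p -> 'I_(n i)} | (\sum_(q < p) l q <= (n i).-1)%N)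
            (pochhammer (- (n i)%:R + 1) (\sum_(q < p) l q)%N / (l i)`!%:R
             * (\prod_(q < p | q != i)
                  (pochhammer (n q)%:R (l q)
                   / ((l q)`!%:R * (c q - c i) ^+ l q)))
             * (hermite R ((n i).-1 - \sum_(q < p) l q)%N).[c i / 2] * x ^+ l i),
      1 / ((2 * Num.sqrt beta) ^+ vsize n
           * 2 `^ (2 * beta + c i * Num.sqrt beta))
        * (jacobi_pineiroI n (fun q => beta + c q * Num.sqrt beta) beta i).[
             (x + Num.sqrt beta) / (2 * Num.sqrt beta)]
        @[beta --> +oo%R] --> (multiple_hermiteI n c i).[x]
    & Num.sqrt (2 * beta) ^+ vsize n
        * beta `^ (beta + c i * Num.sqrt (beta / 2)) * expR (- beta)
        * (multiple_laguerreI n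
             (fun q => beta + c q * Num.sqrt (beta / 2)) i).[
             Num.sqrt (2 * beta) * x + beta]
        @[beta --> +oo%R] --> (multiple_hermiteI n c i).[x]].
Proof.
have N0 : (0 < vsize n)%N by rewrite (leq_trans ni_ge1) // le_vsize.
have E : (multiple_hermiteI n c i).[x] =
    leading_factor c n i * local_residue c n i x.
  by rewrite multiple_hermiteIE // hermiteI_sol_residue.
split; rewrite E; first last.
- exact: cvg_laguerre.
- exact: cvg_jacobi_pineiro.
rewrite local_residue_sumE // /leading_factor.
have h1 := factS_neq0 R (n i).-1.
have sg : (-1) ^+ (n i).-1 * (-1) ^+ (n i).-1 = 1 :> R by rewrite -expr2 sqrr_sign.
move: (local_residue _ _ _ _) (2 ^+ _) (expR _) (\prod_(q | _) _) => L P X D.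
transitivity (((-1) ^+ (n i).-1 * (-1) ^+ (n i).-1) * (P / Num.sqrt pi * X / D * L)).
  by rewrite sg mul1r.
rewrite invfM; move: D^-1 (Num.sqrt pi)^-1 => D' S.
by field.
Qed.
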